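(* Let $G$ be an $n$-vertex graph which is an $(\varepsilon,s)$-expander with $2^{-7}\le\varepsilon\le 1$ and $s\ge\log^{135} n$. Let $V\subseteq V(G)$ be chosen by including each vertex independently at random with probability $\frac13$. Then, with high probability, there is a subgraph of $G$ with at most $2^{9}n\log^{10} n$ edges which is $(\log^7 n,2)$-path connected through $V$.
   Context: Graphs are finite and simple; logarithms have base two and $\log^k n=(\log n)^k$. For a graph $G$ and $F\subseteq E(G)$, $G-F$ is $G$ with the edges of $F$ deleted. $N_G(U)$ is the set of vertices in $V(G)\setminus U$ with a neighbour in $U$. An $n$-vertex graph $G$ is an $(\varepsilon,s)$-expander if, for every $U\subseteq V(G)$ and $F\subseteq E(G)$ with $1\le|U|\le\frac23 n$ and $|F|\le s|U|$, we have $|N_{G-F}(U)|\ge \frac{\varepsilon|U|}{\log^2 n}$. A path through a vertex set $V$ is a path all of whose internal vertices lie in $V$ (its endvertices need not be in $V$). A graph $G$ is $(\ell,t)$-path connected through a vertex subset $V\subseteq V(G)$ if, for any finite multiset $\mathcal{P}$ of unordered pairs of distinct vertices of $G$ in which every vertex appears in at most $t$ pairs (counted with multiplicity), there are pairwise edge-disjoint paths $P_{\{x,y\}}$, one for each (occurrence of a) pair $\{x,y\}\in\mathcal{P}$, such that each $P_{\{x,y\}}$ is a path in $G$ joining $x$ and $y$, through $V$, of length at most $\ell$. ''With high probability'' means with probability tending to $1$ as $n\to\infty$, i.e. the failure probability is at most some $\delta(n)\to 0$, where $\delta$ depends only on $n$ (not on $G,\varepsilon,s$). *)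

(* Defs.v *)
From mathcomp Require Import all_boot all_order all_algebra.
From mathcomp Require Import boolp reals exp.
Set Implicit Arguments.
Unset Strict Implicit.
Unset Printing Implicit Defensive.
Import Order.TTheory GRing.Theory Num.Theory.
Local Open Scope ring_scope.

Record sgraph (T : finType) := SGraph {
  adj :> rel T;
  adj_sym : symmetric adj;
  adj_irrefl : irreflexive adj }.

Section Graph.
Variable T : finType.
Implicit Types (G H : sgraph T) (U V : {set T}) (F : {set {set T}}).

(* An edge is the two-element set of its endvertices. *)
Definition edges G : {set {set T}} :=
  [set [set z.1; z.2] | z : T * T & adj G z.1 z.2].

Definition del_rel G F : rel T :=
  fun x y => adj G x y && ([set x; y] \notin F).

Lemma del_sym G F : symmetric (del_rel G F).
Proof. by move=> x y; rewrite /del_rel adj_sym setUC. Qed.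

Lemma del_irrefl G F : irreflexive (del_rel G F).
Proof. by move=> x; rewrite /del_rel adj_irrefl. Qed.

Definition del_edges G F : sgraph T := SGraph (del_sym G F) (del_irrefl G F).

Definition nbhd G U : {set T} :=
  [set v | (v \notin U) && [exists u in U, adj G u v]].

(* All graphs over T have vertex set T, so these are the spanning subgraphs. *)
Definition subgraph H G : bool := edges H \subset edges G.

(* The path with vertex sequence x :: p. *)
Definition walk_edges (x : T) (p : seq T) : {set {set T}} :=
  [set:: pairmap (fun u v => [set u; v]) x p].

Definition internal (x : T) (p : seq T) : seq T := behead (belast x p).

Definition path_through G V (e : {set T}) (x : T) (p : seq T) : bool :=
  [&& path (adj G) x p, uniq (x :: p), e == [set x; last x p]
    & all (fun v => v \in V) (internal x p)].

End Graph.

Section Real.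
Variable R : realType.

Definition log2 (x : R) : R := ln x / ln 2.

Definition expander (T : finType) (G : sgraph T) (eps s : R) : Prop :=
  forall (U : {set T}) (F : {set {set T}}),
    F \subset edges G ->
    (1 <= #|U|)%N -> #|U|%:R <= 2 / 3 * #|T|%:R :> R ->
    #|F|%:R <= s * #|U|%:R ->
    eps * #|U|%:R / log2 #|T|%:R ^+ 2 <= #|nbhd (del_edges G F) U|%:R.

(* The multiset of pairs is a sequence of two-element sets, its occurrences
   being indexed by positions; Q i is the first vertex of the i-th path together
   with the sequence of its other vertices. *)
Definition path_connected (T : finType) (G : sgraph T) (l : R) (t : nat)
    (V : {set T}) : Prop :=
  forall P : seq {set T},
    all (fun e : {set T} => #|e| == 2) P ->
    (forall v : T, (count (fun e : {set T} => v \in e) P <= t)%N) ->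
    exists Q : 'I_(size P) -> T * seq T,
      (forall i : 'I_(size P),
         path_through G V (nth set0 P i) (Q i).1 (Q i).2 /\
         (size (Q i).2)%:R <= l) /\
      (forall i j : 'I_(size P), i != j ->
         [disjoint walk_edges (Q i).1 (Q i).2 & walk_edges (Q j).1 (Q j).2]).

(* The probability of E V when V contains each element of T independently with
   probability p. *)
Definition rand_subset_prob (T : finType) (p : R) (E : {set T} -> Prop) : R :=
  \sum_(V : {set T} | `[< E V >]) \prod_(v : T) (if v \in V then p else 1 - p).

End Real.

(* Main.v *)
(* Write k = log n. The proof has three ingredients.

   (1) Expansion through V. With high probability N(A), the set of vertices with
   many neighbours in A, and the part of that set with many edges leaving it, all
   meet V in about a third of their vertices, for all A for which they are much
   larger than A: Chernoff's bound then beats the union bound over A. From this, for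
   every F of size at most k^9 |A|, the set N_{G-F}(A) has at least |A| / (2^25 k^4)
   vertices in V as long as A does not contain half of V.

   (2) Routing demands. Iterating (1) and halving the start set, all but |F| / k^9
   vertices x reach more than half of V within O(k^5) steps through V in G - F, so
   among m demand pairs of bounded degree some pair can be joined by a short path
   avoiding any prescribed O(m k^5) edges. Haxell's condition for a system of
   disjoint representatives of hypergraphs then yields edge-disjoint paths for all
   the demands simultaneously.

   (3) Sparsification. The demands are the edges of a Benes network with at least
   2n terminals, two at each vertex of G, whose switches are placed on vertices of
   V, boundedly many on each. Benes networks route every permutation of their
   terminals along edge-disjoint paths with O(k) edges, so the union H of the
   paths found for the demands is path connected through V. *)
Require Import Defs.
From mathcomp Require Import all_boot all_order all_algebra.
From mathcomp Require Import boolp reals exp.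
From mathcomp Require Import zify ring lra.
Set Implicit Arguments.
Unset Strict Implicit.
Unset Printing Implicit Defensive.
Import Order.TTheory GRing.Theory Num.Theory.

(** * Disjoint representatives of hypergraphs *)

Lemma card_bigcup_leq (I E : finType) (A : {set I}) (F : I -> {set E}) :
  #|\bigcup_(i in A) F i| <= \sum_(i in A) #|F i|.
Proof.
elim/big_rec2: _ => [|i m B _ le]; first by rewrite cards0.
by apply: leq_trans (leq_card_setU _ _) _; rewrite leq_add2l.
Qed.

Section Haxell.
Variables (I E : finType) (valid : I -> {set E} -> Prop) (l : nat).
Hypothesis valid_size : forall i S, valid i S -> #|S| <= l.
Hypothesis expanding : forall (J : {set I}) (F : {set E}), J != set0 ->
  #|F| <= 2 * l * #|J| -> exists2 i, i \in J & exists2 S, valid i S & [disjoint S & F].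

Definition disjoint_system (D : {set I}) (f : I -> {set E}) :=
  (forall i, i \in D -> valid i (f i)) /\
  (forall i j, i \in D -> j \in D -> i != j -> [disjoint f i & f j]).

Section Augment.
Variables (D : {set I}) (i0 : I).
Implicit Types (f : I -> {set E}) (S : {set E}) (st : seq (I * {set E})).

(** A move [(i, S)] proposes [S] as the set of [i]; the members of the system that block it have to
    be chosen anew first. *)
Definition blockers f S := [set i in D | ~~ [disjoint f i & S]].

Definition blocking f st : {set I} := \bigcup_(x <- st) blockers f x.2.

Definition touched f st :=
  (\bigcup_(x <- st) @snd I {set E} x) :|: \bigcup_(i in blocking f st) f i.

(* The newest move is at the head of the list. *)
Fixpoint alternating f st : Prop :=
  if st is x :: st' then
    [/\ alternating f st', all (fun y => blockers f y.2 != set0) st',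
        valid x.1 x.2, x.1 \in i0 |: blocking f st'
      & [disjoint x.2 & touched f st']]
  else True.

Lemma blocking_cons f x st :
  blocking f (x :: st) = blockers f x.2 :|: blocking f st.
Proof. by rewrite /blocking big_cons. Qed.

Lemma touched_cons f x st :
  touched f (x :: st) = x.2 :|: (\bigcup_(i in blockers f x.2) f i) :|: touched f st.
Proof.
rewrite /touched big_cons blocking_cons bigcup_setU -!setUA; congr (_ :|: _).
by rewrite !setUA; congr (_ :|: _); rewrite setUC.
Qed.

Lemma blockers_disjoint f (x : I * {set E}) st :
  [disjoint x.2 & touched f st] -> [disjoint blockers f x.2 & blocking f st].
Proof.
move=> dx; rewrite -setI_eq0; apply/eqP/setP => i; rewrite !inE.
apply/negP => /andP[/andP[_ /negP ndi]] ib; apply: ndi.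
rewrite disjoint_sym; apply: disjointWr dx.
by apply: subset_trans (subsetUr _ _); apply: bigcup_sup.
Qed.

(** Every move has a blocker of its own: a new set avoids the sets of all earlier blockers, so
    different moves have disjoint sets of blockers. *)
Lemma alternating_size f st : alternating f st ->
  all (fun y => blockers f y.2 != set0) st -> size st <= #|blocking f st|.
Proof.
elim: st => //= x st IH [alt _ _ _ dx] /andP[bx ball].
rewrite blocking_cons cardsU (_ : _ :&: _ = set0); last first.
  by apply/eqP; rewrite setI_eq0; apply: blockers_disjoint.
rewrite cards0 subn0; have := IH alt ball.
by move: bx; rewrite -card_gt0; lia.
Qed.

Lemma blocking_sub f st : blocking f st \subset D.
Proof.
elim: st => [|x st IH]; first by rewrite /blocking big_nil sub0set.
rewrite blocking_cons subUset IH andbT.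
by apply/subsetP => i; rewrite inE => /andP[].
Qed.

(** There are at most as many moves as blockers, and each move and each blocker contributes at most
    [l] elements. The bound is what [expanding] tolerates. *)
Lemma touched_size f st : (forall i, i \in D -> valid i (f i)) ->
  alternating f st -> all (fun y => blockers f y.2 != set0) st ->
  #|touched f st| <= 2 * l * #|i0 |: blocking f st|.
Proof.
move=> vf alt ball; rewrite /touched; apply: leq_trans (leq_card_setU _ _) _.
have h1 : #|\bigcup_(x <- st) x.2| <= l * size st.
  elim: {ball} st alt => [|x st IH] /=; first by rewrite big_nil cards0.
  move=> [alt _ vx _ _]; rewrite big_cons mulnS.
  apply: leq_trans (leq_card_setU _ _) _.
  by rewrite leq_add ?IH // (valid_size vx).
have h2 : #|\bigcup_(i in blocking f st) f i| <= l * #|blocking f st|.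
  apply: leq_trans (card_bigcup_leq _ _) _.
  rewrite mulnC -sum_nat_const; apply: leq_sum => i ib.
  by apply: valid_size (vf i _); apply: (subsetP (blocking_sub f st)).
have h3 := alternating_size alt ball.
have h4 : #|blocking f st| <= #|i0 |: blocking f st| by apply/subset_leq_card/subsetUr.
nia.
Qed.

(** Keeps the older part of an alternating sequence usable once [e], which blocks only a later move,
    has received its new set. *)
Lemma alternating_congr f f' e st : alternating f st ->
  (forall i, i != e -> f' i = f i) -> e \notin blocking f st ->
  (forall x, x \in st -> [disjoint f' e & x.2]) ->
  [/\ alternating f' st, blocking f' st = blocking f st
    & touched f' st = touched f st].
Proof.
move=> alt ff'.
elim: st alt => [|x st IH] /=; first by rewrite /touched /blocking !big_nil !big_set0.
move=> [alt ball vx xJ dx]; rewrite blocking_cons inE negb_or => /andP[ex est] de.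
have {IH}[] := IH alt est; first by move=> y yst; apply: de; rewrite inE yst orbT.
have beq y : y \in x :: st -> blockers f y.2 \subset blocking f (x :: st).
  move=> yst; rewrite /blocking.
  by rewrite (big_rem y) //= subsetUl.
have bl y : y \in x :: st -> blockers f' y.2 = blockers f y.2.
  move=> yst; apply/setP => i; rewrite !inE.
  have [->|/ff'-> //] := eqVneq i e.
  rewrite (de _ yst) andbF.
  have := contra (subsetP (beq y yst) e).
  by rewrite blocking_cons inE negb_or ex est inE => /(_ isT)/negbTE->.
move=> alt' blk' tch'; split.
- split=> //; rewrite ?blk' ?tch' //.
  apply/allP => y yst; rewrite bl ?inE ?yst ?orbT //.
  exact: (allP ball).
- by rewrite !blocking_cons blk' bl ?mem_head.
- rewrite !touched_cons tch' bl ?mem_head //; congr (_ :|: _ :|: _).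
  apply: eq_bigr => i ib; apply: ff'; apply: contraNneq ex => <-; exact: ib.
Qed.

Let base := #|D|.+2.

(* Orders the alternating sequences lexicographically by the numbers of
   blockers, an absent move counting as infinitely many: the sequence of the
   complemented numbers is read as an expansion in base [base]. *)
Fixpoint defect f st :=
  if st is x :: st' then
    defect f st' + (#|D|.+1 - #|blockers f x.2|) * base ^ (#|D| - size st')
  else 0.

(** Digits are at most [base - 1], so the digits newer than [st'] together stay below one unit of
    the last digit of [st']. *)
Lemma defect_cat f st st' : size (st ++ st') <= #|D|.+1 ->
  defect f (st ++ st') + base ^ (#|D|.+1 - size (st ++ st')) <=
  defect f st' + base ^ (#|D|.+1 - size st').
Proof.
elim: st => [|x st IH] //= sz; have {IH} := IH (ltnW sz).
rewrite subSS (subSn (m := size _)) // expnS.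
set b := base ^ (#|D| - size (st ++ st')).
have : #|D|.+1 - #|blockers f x.2| <= #|D|.+1 by exact: leq_subr.
rewrite {2}/base => h1 h2; apply: leq_trans h2.
by rewrite -addnA leq_add2l addnC -mulSn leq_mul2r ltnS h1 orbT.
Qed.

Lemma defect_bound f st : size st <= #|D|.+1 -> defect f st < base ^ #|D|.+1.
Proof.
move=> sz; have := @defect_cat f st [::]; rewrite cats0 [defect _ [::]]/= add0n subn0.
by move=> /(_ sz); apply: leq_trans; rewrite -addn1 leq_add2l expn_gt0.
Qed.

Lemma alternating_cat f st st' : alternating f (st ++ st') -> alternating f st'.
Proof. by elim: st => [|x st IH] /=; [|move=> [/IH]]. Qed.

(** Each round raises the defect, which is bounded, so the induction on the remaining slack ends. A
    blocked newest move is followed by a further move; an unblocked one is carried out, which either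
    serves [i0] or frees a blocker of an older move. *)
Lemma augment_from m f x st : disjoint_system D f -> alternating f (x :: st) ->
  base ^ #|D|.+1 - defect f (x :: st) <= m ->
  exists f', disjoint_system (i0 |: D) f'.
Proof.
elim: m f x st => [|m IH] f x st [vf df] alt.
  have [alt' ball _ _ _] := alt.
  have sz : size (x :: st) <= #|D|.+1.
    rewrite ltnS; apply: leq_trans (alternating_size alt' ball) _.
    exact/subset_leq_card/blocking_sub.
  by have := defect_bound f sz; lia.
have [alt' ball vx xJ dx] := alt => hm.
have sz : size st <= #|D|.
  apply: leq_trans (alternating_size alt' ball) _.
  exact/subset_leq_card/blocking_sub.
have [b0|bN0] := eqVneq (blockers f x.2) set0; last first.
  have ball' : all (fun y => blockers f y.2 != set0) (x :: st) by rewrite /= bN0.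
  have JN0 : i0 |: blocking f (x :: st) != set0.
    by apply/set0Pn; exists i0; rewrite !inE eqxx.
  have [e eJ [S vS dS]] := expanding JN0 (touched_size vf alt ball').
  have altS : alternating f ((e, S) :: x :: st) by [].
  apply: (IH f (e, S) (x :: st)) => //.
  have sz' : size (x :: st) <= #|D|.
    apply: leq_trans (alternating_size alt ball') _.
    exact/subset_leq_card/blocking_sub.
  have bD : #|blockers f S| <= #|D|.
    by apply/subset_leq_card/subsetP => i; rewrite inE => /andP[].
  have := defect_bound f (leqW sz').
  set X := defect f (x :: st) in hm *.
  rewrite [defect f (_ :: _ :: _)]/= -/(defect f (x :: st)) -/X.
  have : 0 < (#|D|.+1 - #|blockers f S|) * base ^ (#|D| - size (x :: st)).
    by rewrite muln_gt0 expn_gt0 andbT subn_gt0 ltnS.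
  by move: (_ * _) => Y; move: (base ^ _) hm => Z; lia.
have unbl i : i \in D -> [disjoint f i & x.2].
  by move=> iD; have /setP/(_ i) := b0; rewrite !inE iD /= => /negbFE.
have upd (A : {set I}) : A \subset i0 |: D ->
    disjoint_system A (fun i => if i == x.1 then x.2 else f i) \/
    exists2 i, i \in A & i \notin x.1 |: D.
  move=> AD; case: (boolP (A \subset x.1 |: D)); last first.
    by move=> /subsetPn[i iA iN]; right; exists i.
  move=> /subsetP Ax; left; split=> [i iA|i j iA jA ij].
    case: eqP => [->//|/eqP ix]; apply: vf.
    by have := Ax i iA; rewrite !inE (negbTE ix).
  have iD := Ax i iA; have jD := Ax j jA; move: iD jD; rewrite !inE.
  case: eqP => [ix|_]; case: eqP => [jx|_] /=.
  - by rewrite ix jx eqxx in ij.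
  - by move=> _ jD; rewrite disjoint_sym unbl.
  - by move=> iD _; rewrite unbl.
  - by move=> iD jD; apply: df.
set f' := fun i => _ in upd.
have [xi0|xi0] := eqVneq x.1 i0.
  exists f'; case: (upd (i0 |: D)) => // -[i]; rewrite xi0 => iA.
  by rewrite iA.
have xB : x.1 \in blocking f st by move: xJ; rewrite !inE (negbTE xi0).
have xD : x.1 \in D by apply: (subsetP (blocking_sub f st)).
have sys' : disjoint_system D f'.
  case: (upd D) => //; first exact: subsetUr.
  by move=> [i iD]; rewrite !inE iD orbT.
(* Giving [x.1] the set [x.2] removes a blocker of some older move [y]; the moves newer than [y] are
   discarded. *)
have [st1 [y [st2 [st_eq xy]]]] :
    exists st1 y st2, st = st1 ++ y :: st2 /\ x.1 \in blockers f y.2.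
  move: xB; elim: (st) => [|y s IHs]; first by rewrite /blocking big_nil inE.
  rewrite blocking_cons inE => /orP[xy|/IHs[s1 [z [s2 [-> xz]]]]].
    by exists [::], y, s.
  by exists (y :: s1), z, s2.
have alty : alternating f (y :: st2) by apply: (@alternating_cat f st1); rewrite -st_eq.
have [alt2 ball2 vy yJ dy] := alty.
have ff' i : i != x.1 -> f' i = f i by rewrite /f' => /negbTE->.
have f'x : f' x.1 = x.2 by rewrite /f' eqxx.
have xN2 : x.1 \notin blocking f st2.
  have := blockers_disjoint dy; rewrite disjoint_subset => /subsetP/(_ _ xy).
  by rewrite inE.
have dxz z : z \in st -> [disjoint f' x.1 & z.2].
  move=> zst; rewrite f'x; apply: disjointWr dx.
  by rewrite /touched (big_rem z) //= -setUA subsetUl.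
have [|alt2' blk2 tch2] := alternating_congr alt2 ff' xN2.
  by move=> z z2; apply: dxz; rewrite st_eq mem_cat inE z2 !orbT.
have by' : blockers f' y.2 = blockers f y.2 :\ x.1.
  apply/setP => i; rewrite !inE; have [->|/ff'->//] := eqVneq i x.1.
  by rewrite dxz ?andbF // st_eq mem_cat mem_head orbT.
have bl2 z : z \in st2 -> blockers f' z.2 = blockers f z.2.
  move=> z2; apply/setP => i; rewrite !inE; have [->|/ff'->//] := eqVneq i x.1.
  rewrite dxz ?andbF; last by rewrite st_eq mem_cat inE z2 !orbT.
  apply/esym; apply: contraNF xN2 => xz.
  by rewrite /blocking (big_rem z) //= !inE xz.
apply: (IH f' y st2) => //.
  split=> //; rewrite ?blk2 ?tch2 //.
  by apply/allP => z z2; rewrite bl2 //; apply: (allP ball2).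
have def2 : defect f' st2 = defect f st2.
  elim: (st2) bl2 => //= z s IHs bl2; rewrite IHs ?bl2 ?mem_head // => w ws.
  by apply: bl2; rewrite inE ws orbT.
(* The digit of [y] grows by one, which outweighs all discarded digits. *)
have sz' : size ((x :: st1) ++ y :: st2) <= #|D|.+1 by rewrite /= -st_eq.
have := defect_cat f sz'; rewrite cat_cons -st_eq; move: hm.
have := defect_bound f (st := x :: st) sz.
move: (defect f (x :: st)) => X; rewrite [defect f (y :: _)]/= [defect f' _]/= def2.
rewrite by' subSS (cardsD1 x.1 (blockers f y.2)) xy add1n subSS.
have bD : #|blockers f y.2 :\ x.1| <= #|D|.
  apply/subset_leq_card/subsetP => i; rewrite !inE => /andP[_ /andP[]] //.
rewrite (subSn bD) mulSn.
have : 0 < base ^ (#|D|.+1 - size (x :: st)) by rewrite expn_gt0.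
rewrite [size (y :: st2)]/= subSS.
move: (base ^ _) (base ^ _) (base ^ _) => a b c.
by move: (_ * _) (defect f st2) => d e; clear; lia.
Qed.

Lemma augment f : disjoint_system D f -> exists f', disjoint_system (i0 |: D) f'.
Proof.
move=> sys; have JN0 : [set i0] != set0 by apply/set0Pn; exists i0; rewrite inE.
have [|e] := @expanding [set i0] set0 JN0; first by rewrite cards0.
rewrite inE => /eqP-> [S vS _].
apply: (@augment_from _ f (i0, S) [::]) => //.
by split=> //=; rewrite ?inE ?eqxx // /touched /blocking !big_nil big_set0 setU0
   -setI_eq0 setI0.
Qed.

End Augment.

(** The index set of the system is enlarged one element at a time, each time by an augmentation. *)
Lemma haxell_system : exists f : I -> {set E},
  (forall i, valid i (f i)) /\ (forall i j, i != j -> [disjoint f i & f j]).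
Proof.
suff H D : exists f, disjoint_system D f.
  have [f [vf df]] := H setT; exists f.
  by split=> [i|i j ij]; [apply: vf|apply: df]; rewrite ?inE.
have [m] := ubnP #|D|; elim: m D => // m IH D; rewrite ltnS => Dm.
have [->|/set0Pn[i iD]] := eqVneq D set0.
  by exists (fun=> set0); split=> i; rewrite inE.
have [|f sysf] := IH (D :\ i); first by move: Dm; rewrite (cardsD1 i D) iD.
have [f' sysf'] := @augment (D :\ i) i f sysf.
by exists f'; rewrite -(setD1K iD).
Qed.

End Haxell.

(** * Rearrangeable networks *)

(* If [a x] were in the orbit of [x] under [a \o b], one of the involutions
   would have a fixed point, so [a] exchanges the orbits of [a \o b] in pairs. *)
Lemma two_involutions_coloring (X : finType) (a b : X -> X) :
  involutive a -> involutive b -> (forall x, a x != x) -> (forall x, b x != x) ->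
  exists c : X -> bool, forall x, c (a x) = ~~ c x /\ c (b x) = ~~ c x.
Proof.
move=> aK bK aN bN; pose g x := a (b x).
have g_inj : injective g by move=> x y /(inv_inj aK)/(inv_inj bK).
have csym := fconnect_sym g_inj.
have ag x : g (a (g x)) = a x by rewrite /g aK bK.
have iter_inj n : injective (iter n g).
  by elim: n => [|n IH] x y //= /g_inj/IH.
have agn i x : iter i g (a (iter i g x)) = a x.
  by elim: i x => // i IH x; rewrite iterSr iterS ag IH.
have noconn x : ~~ fconnect g x (a x).
  apply/negP => /iter_findex; set m := findex _ _ _ => am.
  rewrite -[m]odd_double_half -addnn addnC !iterD -{1}(agn m./2 x) in am.
  have := iter_inj _ _ _ am.
  rewrite -iterD addnC iterD; move: {am} (iter _ _ x) => z.
  case: odd => /= [/(inv_inj aK)|] /esym/eqP; apply/negP; last by rewrite aN.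
  by rewrite eq_sym bN.
pose r x : nat := enum_rank (froot g x).
have rP x y : fconnect g x y -> r x = r y.
  by move=> xy; rewrite /r; congr enum_rank; apply/(fingraph.rootP csym).
have r_a x y : fconnect g x y -> r (a x) = r (a y).
  move=> /iter_findex <-; rewrite -(agn (findex g x y) x).
  by apply/esym/rP/fconnect_iter.
have r_b x : r (b x) = r (a x).
  by rewrite (r_a x (g x)) ?fconnect1 // /g aK.
have rN x : r (a x) != r x.
  by rewrite (inj_eq (inj_comp val_inj enum_rank_inj)) eq_sym (root_connect csym).
exists (fun x => r x < r (a x)) => x; rewrite r_b aK.
have -> : r (a (b x)) = r x by rewrite -(rP x (g x)) // fconnect1.
by split; rewrite -leqNgt ltn_neqAle rN.
Qed.

(** [pos i x] is the place, after [i] stages, of the packet entering at [x]. Injectivity in [x] is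
    what later keeps the routes of different packets from sharing a link. *)
Definition rearrangeable (X : finType) (m : nat) (c : nat -> X -> X) :=
  forall f : X -> X, injective f -> exists pos : nat -> X -> X,
    [/\ forall x, pos 0 x = x, forall x, pos m x = f x,
        forall i, injective (pos i)
      & forall i x, i < m -> pos i.+1 x = pos i x \/ pos i.+1 x = c i (pos i x)].

Definition flip (X : Type) (y : bool * X) := (~~ y.1, y.2).

(** The two outer stages link two copies of the inner network, whose stages run in both copies at
    once. *)
Definition benes_step (X : Type) m (c : nat -> X -> X) i (y : bool * X) :=
  if (i == 0) || (i == m.+1) then flip y else (y.1, c i.-1 y.2).

(* Clos's looping argument: a 2-colouring separates the members of each input
   pair and of each output pair, and the two colour classes are routed through
   the two halves of the network. *)
Lemma rearrangeable_benes (X : finType) m (c : nat -> X -> X) :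
  rearrangeable m c -> rearrangeable m.+2 (benes_step m c).
Proof.
move=> rc f f_inj; pose g := invF f_inj.
have fK : cancel f g by exact: invF_f.
have gK : cancel g f by exact: f_invF.
have flipK : involutive (@flip X) by case=> b x; rewrite /flip /= negbK.
have flipN y : @flip X y != y.
  by case: y => b x; apply/eqP => -[]; case: b.
have same2 (b b' : bool) (x : X) : (b, x) = (b', x) \/ (b, x) = (~~ b', x).
  by case: b b' => [] []; [left|right|right|left].
have [|y|y|col colP] := @two_involutions_coloring _ (@flip X) (fun y => g (flip (f y))) flipK.
- by move=> y; rewrite gK flipK fK.
- exact: flipN.
- by apply/eqP => /(congr1 f); rewrite gK => /eqP; rewrite (negbTE (flipN _)).
have colf y : col (flip y) = ~~ col y by have [] := colP y.
have colg y z : f y = flip (f z) -> col y = ~~ col z.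
  by move=> e; have [_ <-] := colP z; rewrite -e fK.
have sameX y z : y.2 = z.2 -> y = z \/ y = @flip X z.
  case: y z => [b x] [b' x'] /= ->; rewrite /flip /=.
  by case: b b' => [] []; [left|right|right|left].
(* The member of the input pair [x] with colour [b]: the packet that enters copy [b] at [x]. *)
pose pre b x := if col (true, x) == b then (true, x) else (false, x).
have preE y : pre (col y) y.2 = y.
  case: y => b x; rewrite /pre /=; case: b; first by rewrite eqxx.
  by have /= := colf (true, x); rewrite /flip /= => ->; case: (col _).
have col_pre b x : col (pre b x) = b.
  rewrite /pre; case: eqP => [//|]; have := colf (true, x); rewrite /flip /= => ->.
  by case: (col _) b => [] [].
have pre2 b x : (pre b x).2 = x by rewrite /pre; case: eqP.
pose h b x := (f (pre b x)).2.
have h_inj b : injective (h b).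
  move=> x x' /sameX[/f_inj e|/colg]; first by rewrite -(pre2 b x) e pre2.
  by rewrite !col_pre; case: b.
have [P1 [P10 P1m P1i P1s]] := rc _ (h_inj true).
have [P0 [P00 P0m P0i P0s]] := rc _ (h_inj false).
pose P b := if b then P1 else P0.
have PP b : [/\ forall x, P b 0 x = x, forall x, P b m x = h b x,
    forall i, injective (P b i)
  & forall i x, i < m -> P b i.+1 x = P b i x \/ P b i.+1 x = c i (P b i x)].
  by case: b.
(* Stage 0 sends each packet into the copy of its colour, and the last stage only has to correct the
   copy. Beyond the end, [f y] serves as a default. *)
pose pos i y := if i is i'.+1 then
  if i' <= m then (col y, P (col y) i' y.2) else f y else y.
exists pos; split=> //.
- by move=> y; rewrite /pos ltnn.
- case=> [|i] y z //=; case: ifP => _; last exact: f_inj.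
  case=> cyz; have [_ _ Pi _] := PP (col z); rewrite cyz => /Pi.
  by case/sameX=> // yz; move: cyz; rewrite yz colf; case: (col _).
move=> [|i] y; rewrite /pos /benes_step ltnS => im /=.
  have [-> _ _ _] := PP (col y); rewrite /flip; case: y => b x; exact: same2.
rewrite ltnS in im; rewrite im eqSS; have [_ Pm _ Ps] := PP (col y).
have [->|iNm] := eqVneq i m; rewrite ?ltnn.
  rewrite Pm /h preE /flip /=; case: (f y) => b x; exact: same2.
have im' : i < m by rewrite ltn_neqAle iNm.
by rewrite im' /=; case: (Ps i y.2 im') => ->; [left|right].
Qed.

Lemma benes_network d : exists (X : finType) (c : nat -> X -> X),
  [/\ #|X| = 2 ^ d, forall i, injective (c i) & rearrangeable d.*2 c].
Proof.
elim: d => [|d [X [c [cX ci rc]]]].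
  exists unit, (fun _ => id); split; first by rewrite card_unit.
    by move=> _ x y.
  move=> f _; exists (fun _ => id); split=> // [x|_ x y //].
  by case: x (f x) => [] [].
exists (bool * X)%type, (benes_step d.*2 c); split.
- by rewrite card_prod card_bool cX expnS.
- move=> i y z; rewrite /benes_step; case: ifP => _; last first.
    by case: y z => [b x] [b' x'] [/= -> /ci->].
  by case: y z => [b x] [b' x'] [/= /negb_inj-> ->].
- exact: rearrangeable_benes.
Qed.

(** * Random subsets *)

Section RandomSubset.
Local Open Scope ring_scope.
Variables (R : realType) (T : finType).
Implicit Types (p w rho : R) (A V X : {set T}).

Definition weight p V : R := \prod_(v : T) (if v \in V then p else 1 - p).

Lemma weight_ge0 p V : 0 <= p <= 1 -> 0 <= weight p V.
Proof.
move=> /andP[p0 p1]; apply: prodr_ge0 => v _.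
by case: ifP => _ //; rewrite subr_ge0.
Qed.

(** The moment generating function of a binomial count, which factors over the vertices by
    independence. *)
Lemma sum_weight_expr p w X :
  \sum_V weight p V * w ^+ #|X :&: V| = (1 - p + p * w) ^+ #|X|.
Proof.
transitivity (\prod_(v : T) ((if v \in X then p * w else p) + (1 - p))).
  rewrite bigA_distr; apply: eq_bigr => V _.
  have -> : w ^+ #|X :&: V| = \prod_(v : T) (if v \in X :&: V then w else 1).
    by rewrite -big_mkcond /= prodr_const.
  rewrite /weight -big_split /=; apply: eq_bigr => v _; rewrite !inE.
  by case: (v \in X); case: (v \in V); rewrite /= ?mulr1.
rewrite -prodr_const [RHS]big_mkcond /=; apply: eq_bigr => v _.
by case: ifP => _; [rewrite addrC | rewrite addrC subrK].
Qed.

Lemma sum_weight p : \sum_V weight p V = 1.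
Proof.
transitivity (\sum_V weight p V * (0 : R) ^+ #|(set0 : {set T}) :&: V|).
  by apply: eq_bigr => V _; rewrite set0I cards0 expr0 mulr1.
by rewrite sum_weight_expr cards0 expr0.
Qed.

Lemma sum_weight_card p X : \sum_V weight p V * #|X :&: V|%:R = p * #|X|%:R.
Proof.
under eq_bigr => V _ do rewrite -sum1_card natr_sum mulr_sumr big_mkcond /=.
rewrite exchange_big /= -sum1_card natr_sum mulr_sumr [RHS]big_mkcond /=.
apply: eq_bigr => v _; case: (boolP (v \in X)) => vX; last first.
  by apply: big1 => V _; rewrite !inE (negbTE vX).
(* [0 ^+ #|[set v] :&: V|] is the indicator of [v \notin V]. *)
transitivity (\sum_V (weight p V - weight p V * (0 : R) ^+ #|[set v] :&: V|)).
  apply: eq_bigr => V _; rewrite !inE vX /=.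
  have [vV|vV] := boolP (v \in V).
    rewrite (_ : _ :&: _ = [set v]) ?cards1 ?expr1 ?mulr0 ?subr0 ?mulr1 //.
    by apply/setIidPl; rewrite sub1set.
  rewrite (_ : _ :&: _ = set0) ?cards0 ?expr0 ?mulr1 ?subrr //.
  by apply/eqP; rewrite setI_eq0 disjoints1.
rewrite sumrB sum_weight sum_weight_expr cards1 expr1 mulr0 addr0 mulr1.
by rewrite opprB addrC subrK.
Qed.

Lemma prob_markov p (E : {set T} -> Prop) (g : {set T} -> R) :
  0 <= p <= 1 -> (forall V, 0 <= g V) -> (forall V, E V -> 1 <= g V) ->
  rand_subset_prob p E <= \sum_V weight p V * g V.
Proof.
move=> p01 g0 g1; rewrite /rand_subset_prob big_mkcond /=.
apply: ler_sum => V _; rewrite -/(weight p V).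
have w0 := weight_ge0 V p01; case: asboolP => [/g1 gV|_]; last exact: mulr_ge0.
by rewrite ler_peMr.
Qed.

Lemma prob_mono p (E E' : {set T} -> Prop) : 0 <= p <= 1 ->
  (forall V, E V -> E' V) -> rand_subset_prob p E <= rand_subset_prob p E'.
Proof.
move=> p01 EE'; rewrite /rand_subset_prob big_mkcond [leRHS]big_mkcond /=.
apply: ler_sum => V _; have w0 := weight_ge0 V p01.
case: asboolP => [/EE' E'V|_]; first by rewrite asboolT.
by case: asboolP.
Qed.

Lemma prob_or p (E E' : {set T} -> Prop) : 0 <= p <= 1 ->
  rand_subset_prob p (fun V => E V \/ E' V) <=
  rand_subset_prob p E + rand_subset_prob p E'.
Proof.
move=> p01; rewrite /rand_subset_prob big_mkcond [X in _ <= X + _]big_mkcond.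
rewrite [X in _ <= _ + X]big_mkcond -big_split /=.
apply: ler_sum => V _; have w0 := weight_ge0 V p01.
case: asboolP => [[EV|EV]|_].
- by rewrite (asboolT EV) lerDl; case: ifP.
- by rewrite (asboolT EV) lerDr; case: ifP.
- by rewrite addr_ge0 //; case: ifP.
Qed.

Lemma prob_le1 p (E : {set T} -> Prop) : 0 <= p <= 1 -> rand_subset_prob p E <= 1.
Proof.
move=> p01; rewrite -(sum_weight p); under [leRHS]eq_bigr do rewrite -[weight _ _]mulr1.
exact: prob_markov.
Qed.

(** Turns the upper tail of [#|V|] into a lower tail, so that one tail bound serves for both. *)
Lemma prob_compl p (E : {set T} -> Prop) :
  rand_subset_prob p (fun V => E (~: V)) = rand_subset_prob (1 - p) E.
Proof.
rewrite /rand_subset_prob (reindex_inj (inv_inj (@setCK T))) /=.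
under eq_bigl do rewrite setCK.
apply: eq_bigr => V _; apply: eq_bigr => v _; rewrite inE subKr.
by case: (v \in V).
Qed.

(* Summing [x ^+ #|A|] over all [A] costs only a factor of the order of [n]:
   this is the union bound over [A]. *)
Lemma sum_expr_card_le (x : R) : 0 <= x -> 2 * #|T|%:R * x <= 1 ->
  \sum_(A : {set T} | A != set0) x ^+ #|A| <= 2 * #|T|%:R * x.
Proof.
move=> x0 nx.
have tot : \sum_(A : {set T}) x ^+ #|A| = (1 + x) ^+ #|T|.
  transitivity (\prod_(v : T) (x + 1)); last by rewrite prodr_const addrC.
  rewrite bigA_distr; apply: eq_bigr => A _.
  by rewrite -big_mkcond prodr_const.
have -> : \sum_(A : {set T} | A != set0) x ^+ #|A| = (1 + x) ^+ #|T| - 1.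
  by rewrite -tot [in RHS](bigD1 set0) //= cards0 expr0 addrAC subrr add0r.
rewrite lerBlDr; elim: #|T| nx => [|m IH] nx; first by rewrite expr0; lra.
have m0 : 0 <= m%:R :> R by [].
rewrite exprSr; rewrite -natr1 in nx *.
have /IH h : 2 * m%:R * x <= 1 by nra.
apply: (@le_trans _ _ ((2 * m%:R * x + 1) * (1 + x))); last by nra.
by rewrite ler_wpM2r // addr_ge0.
Qed.

(* Chernoff's method with a fixed tilt [w]: [E w^(c |X :&: V| - d |X|)] is at
   most [rho ^ |X|]. *)
Lemma prob_sparse_image p w rho x (f : {set T} -> {set T}) (c d Lam : nat) :
  0 <= p <= 1 -> 0 < w <= 1 -> 0 <= rho <= 1 ->
  1 - p + p * w ^+ c <= rho * w ^+ d -> rho ^+ Lam <= x ->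
  2 * #|T|%:R * x <= 1 ->
  rand_subset_prob p (fun V => exists A : {set T},
    [/\ A != set0, (Lam * #|A| <= #|f A|)%N
      & (c * #|f A :&: V| < d * #|f A|)%N]) <= 2 * #|T|%:R * x.
Proof.
move=> p01 /andP[w0 w1] /andP[r0 r1] hw hx nx.
have x0 : 0 <= x by apply: le_trans hx; exact: exprn_ge0.
pose sel A := (A != set0) && (Lam * #|A| <= #|f A|)%N.
(* As [w <= 1], the summand of an undersampled image is at least 1, so [g] dominates the indicator
   of the event. *)
pose g V := \sum_(A | sel A) (w ^+ c) ^+ #|f A :&: V| / w ^+ (d * #|f A|).
have term0 A V : 0 <= (w ^+ c) ^+ #|f A :&: V| / w ^+ (d * #|f A|).
  by rewrite divr_ge0 // ?exprn_ge0 // ltW.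
apply: le_trans (prob_markov (g := g) p01 _ _) _.
- by move=> V; apply: sumr_ge0.
- move=> V [A [A0 fA few]]; rewrite /g (bigD1 A) /=; last by rewrite /sel A0.
  rewrite -[X in X <= _]addr0 lerD //; last exact: sumr_ge0.
  rewrite ler_pdivlMr ?exprn_gt0 // mul1r -exprM.
  by rewrite ler_wiXn2l ?(ltW w0) ?(ltnW few).
apply: le_trans (sum_expr_card_le x0 nx).
rewrite /g; under eq_bigr do rewrite mulr_sumr.
rewrite exchange_big /= [leRHS]big_mkcond [leLHS]big_mkcond /=.
apply: ler_sum => A _; rewrite /sel; case: ifP => [/andP[-> hA]|_]; last first.
  by case: ifP => // _; exact: exprn_ge0.
under eq_bigr do rewrite mulrA.
rewrite -mulr_suml sum_weight_expr ler_pdivrMr ?exprn_gt0 //.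
have q0 : 0 <= 1 - p + p * w ^+ c.
  case/andP: p01 => p0 p1; rewrite addr_ge0 ?subr_ge0 // mulr_ge0 //.
  by rewrite exprn_ge0 // ltW.
apply: (@le_trans _ _ ((rho * w ^+ d) ^+ #|f A|)); first by rewrite lerXn2r // nnegrE // mulr_ge0 // exprn_ge0 // ltW.
rewrite exprMn -exprM ler_wpM2r ?exprn_ge0 ?(ltW w0) //.
apply: (@le_trans _ _ ((rho ^+ Lam) ^+ #|A|)).
  by rewrite -exprM ler_wiXn2l.
by rewrite lerXn2r // nnegrE exprn_ge0.
Qed.

Lemma bernoulli_le (y : R) m : 0 <= y -> 1 + m%:R * y <= (1 + y) ^+ m.
Proof.
move=> y0; elim: m => [|m IH]; first by rewrite expr0 mul0r addr0.
have m0 : 0 <= m%:R :> R by [].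
rewrite exprS -natr1; apply: (@le_trans _ _ ((1 + y) * (1 + m%:R * y))); first by nra.
by rewrite ler_wpM2l // addr_ge0.
Qed.

(** Bernoulli's inequality gives [(1 + 1/m)^m >= 2]. *)
Lemma expr_le_half (r : R) m : (0 < m)%N -> 0 <= r -> r * (1 + m%:R^-1) <= 1 ->
  r ^+ m <= 2^-1.
Proof.
move=> m0 r0 hr; have mR : 0 < m%:R :> R by rewrite ltr0n.
have i0 : 0 <= m%:R^-1 :> R by rewrite invr_ge0 ltW.
have := bernoulli_le m i0; rewrite mulfV ?gt_eqF // => b2.
have : (r * (1 + m%:R^-1)) ^+ m <= 1 by rewrite exprn_ile1 // mulr_ge0 // addr_ge0.
rewrite exprMn; have := exprn_ge0 m r0; move: (r ^+ m) (_ ^+ m) b2 => a b; nra.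
Qed.

(** The probabilistic method: elements are kept with probability [1/Q]. In the expectation of [g]
    the normalised size of the sample contributes 1/2, and the vertices left with too few neighbours
    contribute less than 1/2, so [g W < 1] for some [W]. *)
Lemma sample_set (nb : T -> {set T}) (A : {set T}) Q theta : (0 < Q)%N ->
  (2 * #|T| < 2 ^ theta)%N ->
  exists2 A' : {set T}, A' \subset A & (Q * #|A'| <= 2 * #|A|)%N /\
    forall v, (4 * Q * theta <= #|A :&: nb v|)%N -> (theta <= #|A' :&: nb v|)%N.
Proof.
move=> Q0 nth; have [->|A0] := eqVneq A set0.
  exists set0 => //; split=> [|v]; first by rewrite cards0 muln0.
  by rewrite !set0I cards0; case: (theta) => // t; nia.
have QR : 0 < Q%:R :> R by rewrite ltr0n.
have Q1 : 1 <= Q%:R :> R by rewrite ler1n.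
have AR : 0 < #|A|%:R :> R by rewrite ltr0n card_gt0.
pose p : R := Q%:R^-1.
have p01 : 0 <= p <= 1 by rewrite invr_ge0 ltW //= invf_le1.
pose C : R := Q%:R / (2 * #|A|%:R).
pose big v := (4 * Q * theta <= #|A :&: nb v|)%N.
pose g W : R := #|A :&: W|%:R * C +
  \sum_(v | big v) 2 ^+ theta * 2^-1 ^+ #|(A :&: nb v) :&: W|.
have t0 W v : 0 <= 2 ^+ theta * 2^-1 ^+ #|(A :&: nb v) :&: W| :> R.
  by rewrite mulr_ge0 ?exprn_ge0 ?invr_ge0.
have a0 W : 0 <= #|A :&: W|%:R * C :> R.
  by rewrite mulr_ge0 // divr_ge0 // mulr_ge0.
have [W gW] : exists W, g W < 1.
  apply/not_existsP => gN.
  have : 1 <= \sum_W weight p W * g W.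
    rewrite -{1}(sum_weight p); apply: ler_sum => W _.
    have := gN W; move=> /negP; rewrite -leNgt => gW.
    by rewrite ler_peMr // weight_ge0.
  apply/negP; rewrite -ltNge /g.
  under eq_bigr do rewrite mulrDr mulrA mulr_sumr.
  rewrite big_split /= -mulr_suml sum_weight_card exchange_big /=.
  have -> : p * #|A|%:R * C = 2^-1.
    by rewrite /p /C; field; rewrite !gt_eqF.
  (* The threshold [4 * Q * theta] provides [2 * theta] such halvings: half of them cancel
     [2 ^+ theta], the others beat the number of vertices. *)
  have half : (1 - p + p * 2^-1) ^+ (2 * Q) <= 2^-1.
    have e : p * Q%:R = 1 by rewrite /p mulVf ?gt_eqF.
    apply: expr_le_half; rewrite ?muln_gt0 //; first by move: p01; lra.
    have -> : ((2 * Q)%:R : R)^-1 = p / 2 by rewrite natrM invfM mulrC.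
    by move: p01 => /andP[? ?]; nra.
  have le v : big v -> \sum_W weight p W * (2 ^+ theta * 2^-1 ^+ #|(A :&: nb v) :&: W|)
      <= 2^-1 ^+ theta.
    move=> bv; under eq_bigr do rewrite mulrCA.
    rewrite -mulr_sumr sum_weight_expr.
    have q0 : 0 <= 1 - p + p * 2^-1 by move: p01; lra.
    have q1 : 1 - p + p * 2^-1 <= 1 by move: p01; lra.
    apply: (@le_trans _ _ (2 ^+ theta * (2^-1 ^+ theta * 2^-1 ^+ theta))).
      rewrite ler_wpM2l ?exprn_ge0 //.
      apply: le_trans (ler_wiXn2l q0 q1 bv) _.
      have -> : (4 * Q * theta = (2 * Q) * (2 * theta))%N by nia.
      rewrite exprM -exprD addnn -mul2n.
      by rewrite lerXn2r ?nnegrE ?exprn_ge0 ?invr_ge0.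
    by rewrite mulrA -exprMn (@mulfV R 2) ?pnatr_eq0 // expr1n mul1r.
  have : \sum_(v | big v) \sum_W weight p W *
     (2 ^+ theta * 2^-1 ^+ #|(A :&: nb v) :&: W|) <= #|T|%:R * 2^-1 ^+ theta.
    apply: le_trans (ler_sum _ le) _.
    rewrite sumr_const -[leLHS]mulr_natl ler_wpM2r ?exprn_ge0 ?invr_ge0 // ler_nat.
    exact: max_card.
  have : #|T|%:R * 2^-1 ^+ theta < 2^-1 :> R.
    rewrite exprVn ltr_pdivrMr ?exprn_gt0 //.
    by move: nth; rewrite -(ltr_nat R) natrM natrX; lra.
  by move: (\sum_(v | _) _) => X; lra.
exists (A :&: W); first exact: subsetIl.
split=> [|v bv].
  have : #|A :&: W|%:R * C < 1 :> R.
    by apply: le_lt_trans gW; rewrite lerDl sumr_ge0.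
  rewrite mulrA ltr_pdivrMr ?mulr_gt0 // mul1r -!natrM ltr_nat; lia.
have : 2 ^+ theta * 2^-1 ^+ #|(A :&: nb v) :&: W| < 1 :> R.
  apply: le_lt_trans gW; rewrite /g (bigD1 v) //= addrCA lerDl.
  by rewrite addr_ge0 // sumr_ge0.
rewrite setIAC; move: #|_| => m; rewrite exprVn ltr_pdivrMr ?exprn_gt0 // mul1r.
by rewrite ltr_eXn2l ?ltr1n // => /ltnW.
Qed.

End RandomSubset.

(** * Expansion through a random vertex set *)

(** Of [y] vertices, [y1] survive in a set of size [N] and [y2] are cut off by [F] at [theta] edges
    each; both counts are at most [a / tau]. *)
Lemma lost_count_le tau sigma theta a N F y y1 y2 : 0 < theta ->
  tau * N < a -> F <= sigma * a -> tau * sigma <= theta ->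
  y = y1 + y2 -> y1 <= N -> theta * y2 <= F -> tau * y <= 2 * a.
Proof.
move=> th0 h1 h2 h3 -> h4 h5; have : tau * y1 <= a by nia.
have : tau * y2 <= a; last by lia.
case: sigma h2 h3 => [|s] h2 h3; first by have -> : y2 = 0; nia.
rewrite -(@leq_pmul2l s.+1) //; nia.
Qed.

(** Makes a sample of size [c] so small that the set of size [b] it determines is [Lam] times
    larger, as fairness demands. *)
Lemma sample_small E2 Lam Q a b c : 0 < E2 -> a <= E2 * b -> Q * c <= 2 * a ->
  2 * Lam * E2 <= Q -> Lam * c <= b.
Proof.
move=> E0 h1 h2 h3; rewrite -(@leq_pmul2l (2 * E2)) ?muln_gt0 //.
have : 2 * Lam * E2 * c <= Q * c by rewrite leq_mul2r h3 orbT.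
nia.
Qed.

(** Final double count: [z] heavy vertices send [S] edges each to at most [Lam * a + a] vertices
    receiving at most [D] each. *)
Lemma heavy_count_absurd S D e Lam a z : 0 < Lam -> 0 < a -> a <= 4 * e * z ->
  D * (16 * e * Lam) < S -> ~ S * z <= D * (Lam * a + a).
Proof.
move=> L0 a0 az SD Sz; have z0 : 0 < z by case: z az {Sz} => //; rewrite muln0; lia.
have : D * (Lam * a + a) <= D * (2 * Lam * (4 * e * z)).
  by rewrite leq_mul2l; apply/orP; right; nia.
have : D * (16 * e * Lam) * z < S * z by rewrite ltn_pmul2r.
nia.
Qed.

(** * Counting edges between vertex sets *)

Section Counting.
Variables (T : finType) (G : sgraph T).
Implicit Types (A Y Z : {set T}) (F : {set {set T}}).

Definition nbrs v := [set u | adj G u v].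

Definition cut A Y : {set {set T}} :=
  [set [set z.1; z.2] | z : T * T & [&& z.1 \in A, z.2 \in Y & adj G z.1 z.2]].

Lemma cut_sub A Y : cut A Y \subset edges G.
Proof.
apply/subsetP => e /imsetP[z]; rewrite inE => /and3P[_ _ az] ->.
by apply/imsetP; exists z; rewrite ?inE.
Qed.

Lemma card_pairs A Y (r : rel T) :
  #|[set z : T * T | [&& z.1 \in A, z.2 \in Y & r z.1 z.2]]| =
  \sum_(v in Y) #|[set u in A | r u v]|.
Proof.
rewrite -sum1_card (eq_bigl (fun z : T * T => (z.2 \in Y) && ((z.1 \in A) && r z.1 z.2))).
  rewrite (reindex_inj (inv_inj (f := fun z : T * T => (z.2, z.1)) _)) /=; last by case.
  rewrite -(pair_big_dep (fun v => v \in Y) (fun v u => (u \in A) && r u v) (fun _ _ => 1)) /=.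
  apply: eq_bigr => v _; rewrite sum1dep_card; apply: eq_card => u.
  by rewrite !inE.
by move=> z; rewrite inE andbCA.
Qed.

Lemma sum_card_exchange A Y (r : rel T) :
  \sum_(v in Y) #|[set u in A | r u v]| = \sum_(u in A) #|[set v in Y | r u v]|.
Proof.
under eq_bigr do rewrite -sum1_card big_mkcond /=.
rewrite exchange_big /= [RHS]big_mkcond /=; apply: eq_bigr => u _.
rewrite -sum1_card big_mkcond [X in _ = if _ then X else _]big_mkcond /=.
case: (boolP (u \in A)) => uA.
  by apply: eq_bigr => v _; rewrite !inE uA /=; case: (v \in Y).
by apply: big1 => v _; rewrite !inE (negbTE uA); case: (v \in Y).
Qed.

Lemma nbrsI A v : A :&: nbrs v = [set u in A | adj G u v].
Proof. by apply/setP => u; rewrite !inE. Qed.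

Lemma card_cut_le A Y : #|cut A Y| <= \sum_(v in Y) #|A :&: nbrs v|.
Proof.
apply: leq_trans (leq_imset_card _ _) _; rewrite card_pairs.
by apply: leq_sum => v _; rewrite nbrsI.
Qed.

Lemma sum_nbrs_exchange A Y :
  \sum_(v in Y) #|A :&: nbrs v| = \sum_(u in A) #|Y :&: nbrs u|.
Proof.
under eq_bigr do rewrite nbrsI.
rewrite sum_card_exchange; apply: eq_bigr => u _; rewrite nbrsI.
by apply: eq_card => v; rewrite !inE adj_sym.
Qed.

(** Since [A] and [Y] are disjoint, an edge determines which of its ends lies in which set, so no
    edge is counted twice. *)
Lemma sum_edges_le A Y F : [disjoint A & Y] ->
  \sum_(v in Y) #|[set u in A | [set u; v] \in F]| <= #|F|.
Proof.
move=> dAY; rewrite -card_pairs.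
set P := [set _ | _].
have inj : {in P &, injective (fun z : T * T => [set z.1; z.2])}.
  move=> [u v] [u' v']; rewrite !inE /= => /and3P[uA vY _] /and3P[uA' vY' _] e.
  have AY x : x \in A -> x \in Y -> False.
    by move=> xA xY; have /pred0P/(_ x) := dAY; rewrite /= xA xY.
  have := set21 u v; rewrite e !inE => /orP[]/eqP eu; last first.
    by case: (AY u); rewrite ?eu // -eu.
  have := set22 u v; rewrite e !inE => /orP[]/eqP ev.
    by case: (AY v); rewrite ?ev // -ev.
  by rewrite eu ev.
rewrite -(card_in_imset inj); apply/subset_leq_card/subsetP => e /imsetP[z].
by rewrite inE => /and3P[_ _ zF] ->.
Qed.

Lemma nbhd_del_cut A Y : nbhd (del_edges G (cut A Y)) A \subset ~: Y.
Proof.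
apply/subsetP => v; rewrite !inE => /andP[vA /existsP[u /andP[uA]]].
rewrite /= /del_rel => /andP[uv]; apply: contra => vY.
by apply/imsetP; exists (u, v); rewrite // inE /= uA vY.
Qed.

Lemma nbhdP A v : reflect (v \notin A /\ exists2 u, u \in A & adj G u v)
  (v \in nbhd G A).
Proof.
rewrite inE; apply: (iffP andP) => -[vA].
  by move=> /existsP[u /andP[uA uv]]; split=> //; exists u.
by move=> [u uA uv]; split=> //; apply/existsP; exists u; rewrite uA.
Qed.

Lemma nbhd_del_sub A F : nbhd (del_edges G F) A \subset nbhd G A.
Proof.
apply/subsetP => v; rewrite inE => /andP[vA /existsP[u /andP[uA /andP[uv _]]]].
by apply/nbhdP; split=> //; exists u.
Qed.

(* Losing an outside vertex with [d] neighbours in [A] costs [d] edges of [F]. *)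
Lemma card_cut_off A F Y d : (forall v, v \in Y -> v \notin A) ->
  (forall v, v \in Y -> d <= #|A :&: nbrs v|) ->
  d * #|Y :\: nbhd (del_edges G F) A| <= #|F|.
Proof.
move=> YA Yd; set X := Y :\: _.
have dAX : [disjoint A & X].
  rewrite disjoint_sym disjoint_subset; apply/subsetP => v.
  by rewrite inE => /andP[_ /YA]; rewrite !inE.
apply: leq_trans (sum_edges_le F dAX); rewrite mulnC -sum_nat_const.
apply: leq_sum => v; rewrite inE => /andP[vN vY].
apply: leq_trans (Yd v vY) _; apply/subset_leq_card/subsetP => u.
rewrite !inE => /andP[uA uv]; rewrite uA /=.
apply: contraNT vN => uvF; rewrite inE YA //=.
by apply/existsP; exists u; rewrite uA /= /del_rel uv.
Qed.

End Counting.

Section Expansion.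
Variables (T : finType) (G : sgraph T) (E S Lam theta Q tau sigma : nat).

(** Expansion in integers: [1/E] stands for the factor eps / log^2 n and [S] for [s]. *)
Definition robust_expander := forall (U : {set T}) (F : {set {set T}}),
  F \subset edges G -> 0 < #|U| -> 3 * #|U| <= 2 * #|T| -> #|F| <= S * #|U| ->
  #|U| <= E * #|nbhd (del_edges G F) U|.

Definition popular (A : {set T}) := [set v | theta <= #|A :&: nbrs G v|].

Definition heavy (B : {set T}) := [set w in B | S <= #|~: B :&: nbrs G w|].

(** The share 3/10 lies just below the sampling density 1/3, which leaves room for Chernoff's bound;
    the factor [Lam] pays for the union bound over [A]. *)
Definition fair (V : {set T}) (f : {set T} -> {set T}) := forall A : {set T},
  A != set0 -> Lam * #|A| <= #|f A| -> 3 * #|f A| <= 10 * #|f A :&: V|.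

Hypothesis expG : robust_expander.

(* Deleting all edges from the light vertices of [B] to the outside of [B] leaves
   the light vertices no neighbours but the heavy ones. *)
Lemma card_heavy (B : {set T}) : 3 * #|B| <= 2 * #|T| ->
  #|B| <= E.+1 * #|heavy B|.
Proof.
move=> B2; pose B1 := B :\: heavy B.
have hB : heavy B \subset B by apply/subsetP => w; rewrite inE => /andP[].
have cB : #|B| = #|heavy B| + #|B1|.
  by rewrite -(cardsID (heavy B) B) (setIidPr hB).
have [B1e|B10] := eqVneq B1 set0.
  by rewrite cB B1e cards0 addn0 leq_pmull.
have := @expG B1 (cut G B1 (~: B)) (cut_sub _ _ _) _ _ _.
rewrite card_gt0 B10 => /(_ isT) h.
have {h} : #|B1| <= E * #|nbhd (del_edges G (cut G B1 (~: B))) B1|.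
  apply: h; first by apply: leq_trans B2; rewrite leq_mul2l subset_leq_card // subsetDl.
  apply: leq_trans (card_cut_le _ _ _) _.
  rewrite sum_nbrs_exchange mulnC -sum_nat_const; apply: leq_sum => w.
  by rewrite !inE => /andP[]; case: (w \in B) => //; rewrite -ltnNge => /ltnW.
have : nbhd (del_edges G (cut G B1 (~: B))) B1 \subset heavy B.
  apply/subsetP => v vN; have := subsetP (nbhd_del_cut G B1 (~: B)) _ vN.
  rewrite !inE negbK => vB; rewrite vB /=.
  by move: vN; rewrite !inE vB andbT negbK => /andP[/andP[]].
move=> /subset_leq_card; nia.
Qed.

Hypotheses (H1 : 10 * sigma.+1 < 3 * Lam) (H2 : 4 * Q * theta * Lam <= S)
  (H3 : 2 * #|T| < 2 ^ theta) (H4 : tau * sigma <= theta)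
  (H5 : 2 * Lam * (E * E.+1) <= Q) (H6 : 64 * (E * E.+1) <= tau)
  (H7 : 4 * Q * theta * (16 * (E * E.+1) * Lam) < S).
Variable R : reals.Real.type.
Variable V : {set T}.
Hypotheses (V8 : 8 * #|V| <= 3 * #|T|) (fN : fair V (nbhd G))
  (fP : fair V popular) (fH : fair V (fun A => heavy (popular A))).

(* Suppose [A] has almost no neighbours in [V]. A sample [A'] of [A], so small that
   a union bound over its choices is affordable, already determines a set [B]
   containing every vertex with many neighbours in [A], and [B :&: V] lies in [A]
   up to few vertices. As [B] expands, many vertices of [B], hence of [B :&: V] and
   so of [A], have a huge degree to the outside of [B]; a vertex outside [B] has
   few neighbours in [A], so [A] has far more than [Lam * #|A|] neighbours, and
   then also many in [V]. *)
Lemma expansion_through (A : {set T}) (F : {set {set T}}) : A != set0 ->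
  3 * #|A :\: V| <= #|T| -> 2 * #|A :&: V| <= #|V| -> #|F| <= sigma * #|A| ->
  #|A| <= tau * #|V :&: nbhd (del_edges G F) A|.
Proof.
move=> A0 AD AI AF; rewrite leqNgt; apply/negP.
set N := V :&: _; set a := #|A| => tN.
have a0 : 0 < a by rewrite card_gt0.
have cA : a = #|A :&: V| + #|A :\: V| by rewrite cardsID.
(* [A] has at most a third of all vertices outside [V] and at most 3/16 of them inside. *)
have [A2 E0] : 3 * a <= 2 * #|T| /\ 0 < E.
  split; first by lia.
  have := @expG A set0 (sub0set _) _ _ _; rewrite cards0 -/a => /(_ a0) h.
  have : a <= E * #|nbhd (del_edges G set0) A| by apply: h; lia.
  by case: (E) => //; rewrite mul0n; lia.
have EE : 0 < E * E.+1 by rewrite muln_gt0 E0.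
have tau0 : 0 < tau by lia.
have Lam0 : 0 < Lam by lia.
have Q0 : 0 < Q by move: H5; nia.
(* Otherwise 3/10 of the neighbourhood lies in [V], and [F], with at most [sigma * a] edges, leaves
   more than [a] of these vertices. *)
have NA : #|nbhd G A| < Lam * a.
  rewrite ltnNge; apply/negP => big; have := fN A0 big.
  have : 1 * #|(nbhd G A :&: V) :\: nbhd (del_edges G F) A| <= #|F|.
    apply: card_cut_off => v; rewrite inE => /andP[/nbhdP[vA [u uA uv]] _] //.
    by rewrite card_gt0; apply/set0Pn; exists u; rewrite !inE uA.
  have : #|nbhd G A :&: V :&: nbhd (del_edges G F) A| <= #|N|.
    by apply/subset_leq_card/subsetP => v; rewrite !inE => /andP[/andP[_ ->] ->].
  have := cardsID (nbhd (del_edges G F) A) (nbhd G A :&: V).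
  have : #|N| <= a by nia.
  by nia.
pose D1 := 4 * Q * theta.
have [A' A'A [cA' A'P]] := @sample_set R T (nbrs G) A Q theta Q0 H3.
pose B := popular A'.
have AB v : v \notin B -> #|A :&: nbrs G v| < D1.
  by rewrite ltnNge; apply: contra => /A'P h; rewrite inE.
pose P := [set v in ~: A | D1 <= #|A :&: nbrs G v|].
have PB : P \subset B.
  by apply/subsetP => v; rewrite !inE => /andP[_]; exact: A'P.
(* Cutting [A] off from its neighbours outside [P] costs at most [D1 * Lam * a <= S * a] edges, so
   the expansion must come from [P]. *)
have aB : a <= E * #|B|.
  pose Y := nbhd G A :\: P.
  have := @expG A (cut G A Y) (cut_sub _ _ _) a0 A2; rewrite -/a => h.
  have {h} : a <= E * #|nbhd (del_edges G (cut G A Y)) A|.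
    apply: h; apply: leq_trans (card_cut_le _ _ _) _.
    apply: (@leq_trans (D1 * #|Y|)).
      rewrite mulnC -sum_nat_const; apply: leq_sum => v; rewrite !inE.
      move=> /andP[h /andP[vA _]]; move: h; rewrite vA /= -ltnNge.
      exact: ltnW.
    have : #|Y| <= Lam * a.
      by apply: leq_trans (ltnW NA); apply/subset_leq_card/subsetDl.
    by move: H2; rewrite -/D1; nia.
  have : nbhd (del_edges G (cut G A Y)) A \subset B.
    apply: subset_trans PB; apply/subsetP => v vN.
    have vA := subsetP (nbhd_del_sub _ _ _) _ vN.
    have := subsetP (nbhd_del_cut G A Y) _ vN.
    by rewrite in_setC in_setD vA andbT negbK.
  by move=> /subset_leq_card; nia.
have A'0 : A' != set0.
  apply: contraTneq aB => A'e; rewrite -ltnNge.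
  have -> : B = set0.
    apply/setP => v; rewrite !inE A'e set0I cards0 leqn0; apply/negbTE.
    by apply: contraTneq H3 => ->; rewrite -leqNgt expn0; have := max_card (mem A); lia.
  by rewrite cards0 muln0.
(* A vertex of [B] outside [A] has [theta] neighbours in [A]: it stays a neighbour or costs [F] that
   many edges. *)
have BA (X : {set T}) : X \subset B -> tau * #|(X :&: V) :\: A| <= 2 * a.
  move=> XB; set Y := (X :&: V) :\: A.
  have YB v : v \in Y -> v \in B by rewrite !inE => /andP[_ /andP[/(subsetP XB)]]; rewrite !inE.
  have : theta * #|Y :\: nbhd (del_edges G F) A| <= #|F|.
    apply: card_cut_off => v vY; first by move: vY; rewrite !inE => /andP[].
    have := YB v vY; rewrite inE => h; apply: leq_trans h _.
    by apply/subset_leq_card/setSI.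
  have : #|Y :&: nbhd (del_edges G F) A| <= #|N|.
    by apply/subset_leq_card/subsetP => v; rewrite !inE => /andP[/andP[_ /andP[_ ->]] ->].
  have th0 : 0 < theta by case: (theta) H3 => //; rewrite expn0; have := max_card (mem A); lia.
  move=> le1 le2; apply: (lost_count_le th0 tN AF H4 _ le1 le2).
  by rewrite cardsID.
(* [B :&: V] exceeds [A :&: V], hence 3/16 of all vertices, only slightly; fairness multiplies this
   by at most 10/3, giving little more than 5/8. *)
have B2 : 3 * #|B| <= 2 * #|T|.
  have h : 3 * #|B| <= 10 * #|B :&: V|.
    apply: fP => //; apply: (sample_small EE _ cA' H5); rewrite -/a.
    by apply: leq_trans aB _; rewrite leq_mul2r leq_pmulr // orbT.
  have := BA B (subxx _); have := cardsID A (B :&: V).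
  have : #|B :&: V :&: A| <= #|A :&: V|.
    by apply/subset_leq_card/subsetP => v; rewrite !inE => /andP[/andP[_ ->] ->].
  by nia.
have hB := card_heavy B2.
have hsub : heavy B \subset B by apply/subsetP => w; rewrite inE => /andP[].
pose Z := heavy B :&: V :&: A.
have aH : a <= E * E.+1 * #|heavy B| by nia.
have aZ : a <= 4 * (E * E.+1) * #|Z|.
  have h : 3 * #|heavy B| <= 10 * #|heavy B :&: V|.
    exact: (fH A'0) (sample_small EE aH cA' H5).
  have := BA _ hsub; have := cardsID A (heavy B :&: V); rewrite -/Z.
  move: h aH H6; clear; nia.
(* The edges between [Z] and the outside of [B] are counted from both sides; their outer ends lie in
   [A] or its neighbourhood. *)
have : S * #|Z| <= D1 * (Lam * a + a).
  apply: (@leq_trans (\sum_(v in ~: B) #|Z :&: nbrs G v|)).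
    rewrite sum_nbrs_exchange mulnC -sum_nat_const; apply: leq_sum => w.
    by rewrite !inE => /andP[/andP[/andP[_ ->]]].
  rewrite (bigID (fun v => v \in nbhd G A :|: A)) /= [X in _ + X]big1 ?addn0; last first.
    move=> v /andP[_ vN]; apply/eqP; rewrite cards_eq0.
    apply: contraNT vN => /set0Pn[u]; rewrite !inE => /andP[/andP[_ uA] uv].
    by case: (v \in A) => //=; rewrite orbF; apply/existsP; exists u; rewrite uA.
  apply: (@leq_trans (\sum_(v in nbhd G A :|: A) D1)); last first.
    rewrite sum_nat_const mulnC leq_mul2l; apply/orP; right.
    by apply: leq_trans (leq_card_setU _ _) _; rewrite leq_add2r ltnW.
  rewrite big_mkcond [leqRHS]big_mkcond; apply: leq_sum => v _ /=.
  case: ifP => [/andP[vB ->]|_] //; apply: ltnW; apply: leq_ltn_trans (AB v _).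
    by apply/subset_leq_card/setSI/subsetIr.
  by move: vB; rewrite inE.
exact: heavy_count_absurd Lam0 a0 aZ H7.
Qed.

End Expansion.

(** * Routing demands by edge-disjoint walks *)

Lemma sub_of_card (T : finType) (A : {set T}) m : m <= #|A| ->
  exists2 B : {set T}, B \subset A & #|B| = m.
Proof.
move=> mA; exists [set x in take m (enum A)].
  by apply/subsetP => x; rewrite inE => /mem_take; rewrite mem_enum.
rewrite cardsE (card_uniqP _) ?take_uniq ?enum_uniq // size_takel //.
by rewrite -cardE.
Qed.

Section Balls.
Variables (T : finType) (G : sgraph T) (V : {set T}) (F : {set {set T}}).
Implicit Types (A B U : {set T}).

(** One round of a breadth-first search in [G - F] that may enter only vertices of [V]. *)
Definition grow A := A :|: V :&: nbhd (del_edges G F) A.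

Definition ball r A := iter r grow A.

Lemma in_grow A v :
  (v \in grow A) = (v \in A) || (v \in V) && [exists u in A, del_rel G F u v].
Proof. by rewrite !inE; case: (v \in A) => //=. Qed.

Lemma growU A B : grow (A :|: B) = grow A :|: grow B.
Proof.
apply/setP => v; rewrite in_setU !in_grow in_setU.
have -> : [exists u in A :|: B, del_rel G F u v] =
    [exists u in A, del_rel G F u v] || [exists u in B, del_rel G F u v].
  apply/existsP/orP => [[u]|[]/existsP[u /andP[uA uv]]].
  - by rewrite inE andb_orl => /orP[] h; [left|right]; apply/existsP; exists u.
  - by exists u; rewrite inE uA.
  - by exists u; rewrite inE uA orbT.
by do 2!case: existsP => _; case: (v \in A); case: (v \in B); case: (v \in V).
Qed.

Lemma ballU r A B : ball r (A :|: B) = ball r A :|: ball r B.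
Proof. by elim: r => //= r ->; exact: growU. Qed.

Lemma ballD r s A : ball (r + s) A = ball s (ball r A).
Proof. by rewrite /ball addnC iterD. Qed.

Lemma sub_ball r A : A \subset ball r A.
Proof. by elim: r => //= r IH; apply: subset_trans IH _; exact: subsetUl. Qed.

(** The bound on [A :\: V] required by [expV] thus persists for all balls around [A]. *)
Lemma ballDV r A : ball r A :\: V = A :\: V.
Proof.
elim: r => //= r <-; apply/setP => v; rewrite !in_setD in_grow.
by case: (v \in V); rewrite //= orbF.
Qed.

Lemma ball_path r x w : w \in ball r [set x] -> exists p : seq T,
  [/\ path (del_rel G F) x p, last x p = w, size p <= r & all (mem V) p].
Proof.
elim: r w => [|r IH] w; first by rewrite inE => /eqP->; exists [::].
rewrite [ball _ _]/(grow _) in_grow => /orP[/IH[p [pp lp sp Vp]]|].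
  by exists p; split=> //; exact: leqW.
move=> /andP[wV /existsP[u /andP[/IH[p [pp lp sp Vp]] uw]]].
exists (rcons p w); split.
- by rewrite rcons_path pp lp.
- by rewrite last_rcons.
- by rewrite size_rcons.
- by rewrite all_rcons /= wV Vp.
Qed.

Definition large A := #|V| < 2 * #|A :&: V|.

Lemma large_meet A B : large A -> large B -> exists2 w, w \in V & (w \in A) && (w \in B).
Proof.
rewrite /large => lA lB; have : A :&: V :&: (B :&: V) != set0.
  rewrite -card_gt0; have := cardsUI (A :&: V) (B :&: V).
  have : #|A :&: V :|: B :&: V| <= #|V|.
    by apply/subset_leq_card; rewrite subUset !subsetIr.
  lia.
by move=> /set0Pn[w]; rewrite !inE => /andP[/andP[wA wV] /andP[wB _]]; exists w; rewrite ?wA.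
Qed.

Variables (tau sigma k : nat).
Hypotheses (tau0 : 0 < tau) (nk : #|T| < 2 ^ k) (V4 : #|T| <= 4 * #|V|).
Hypothesis expV : forall A : {set T}, A != set0 ->
  3 * #|A :\: V| <= #|T| -> 2 * #|A :&: V| <= #|V| -> #|F| <= sigma * #|A| ->
  #|A| <= tau * #|V :&: nbhd (del_edges G F) A|.

Lemma card_grow A : #|grow A| = #|A| + #|V :&: nbhd (del_edges G F) A|.
Proof.
rewrite cardsU (_ : A :&: _ = set0) ?cards0 ?subn0 //.
by apply/setP => v; rewrite !inE; case: (v \in A); rewrite ?andbF.
Qed.

Lemma large_ball_leq r s A : r <= s -> large (ball r A) -> large (ball s A).
Proof.
move=> /subnKC <-; rewrite ballD /large => h; apply: leq_trans h _.
by rewrite leq_mul2l; apply/orP; right; apply/subset_leq_card/setSI/sub_ball.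
Qed.

(** Until the ball is large, each round multiplies its size by at least [1 + 1/tau]. *)
Lemma ball_growth r A : A != set0 -> 3 * #|A :\: V| <= #|T| -> #|F| <= sigma * #|A| ->
  large (ball r A) \/ tau.+1 ^ r * #|A| <= tau ^ r * #|ball r A|.
Proof.
move=> A0 AV AF; elim: r => [|r [IH|IH]]; first by right.
  by left; apply: large_ball_leq IH.
have [|nl] := boolP (large (ball r A)); first by move=> lr; left; apply: large_ball_leq lr.
right; have sA := sub_ball r A.
have := @expV (ball r A) _ _ _ _; rewrite ballDV => h.
have {h} h : #|ball r A| <= tau * #|V :&: nbhd (del_edges G F) (ball r A)|.
  apply: h => //.
  - by apply: contraNneq A0 => e; rewrite -subset0 -e.
  - by rewrite leqNgt.
  - by apply: leq_trans AF _; rewrite leq_mul2l subset_leq_card ?orbT.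
rewrite [ball r.+1 A]/(grow _) card_grow !expnS -!mulnA.
move: IH h; move: (tau.+1 ^ r * _) (tau ^ r) #|ball r A| #|_ :&: _| => X Y b c h1 h2.
apply: leq_trans (leq_mul (leqnn _) h1) _.
have := leq_mul (leqnn Y) h2; nia.
Qed.

(** [(1 + 1/tau)^tau >= 2], so [tau] rounds of growth amount to a doubling. *)
Lemma expn_tau j : 2 ^ j * tau ^ (tau * j) <= tau.+1 ^ (tau * j).
Proof.
rewrite !expnM -expnMn; have [->|j0] := posnP j; first by rewrite !expn0.
rewrite leq_exp2r //.
have b m : tau ^ m + m * tau ^ m.-1 <= tau.+1 ^ m.
  elim: m => [|m IH]; first by rewrite mul0n.
  rewrite [tau.+1 ^ _]expnS; apply: leq_trans (leq_mul (leqnn _) IH).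
  case: m {IH} => [|m] /=; first by rewrite !expn0 expn1; lia.
  by rewrite !expnS; move: (tau ^ m) => X; nia.
apply: leq_trans (b tau); case: (tau) tau0 => // t _.
by rewrite /= -expnS mul2n addnn.
Qed.

Lemma ball_doubling j A : A != set0 -> 3 * #|A :\: V| <= #|T| ->
  #|F| <= sigma * #|A| -> #|T| < 2 ^ j * #|A| -> large (ball (tau * j) A).
Proof.
move=> A0 AV AF jA; case: (ball_growth (tau * j) A0 AV AF) => // h.
have := max_card (mem (ball (tau * j) A)); have := expn_tau j.
have : 0 < tau ^ (tau * j) by rewrite expn_gt0 tau0.
move: h jA; move: (tau.+1 ^ _) (tau ^ _) (2 ^ _) #|ball _ _| #|A| => X Y Z b a.
move=> h jA Y0 hZ bT; exfalso; suff : Y * #|T| < Y * b by rewrite ltn_pmul2l //; lia.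
apply: leq_trans h; apply: leq_trans (leq_mul hZ (leqnn a)).
by rewrite (mulnC Z) -mulnA ltn_pmul2l.
Qed.

(* One half of [U] reaches half of what [U] reaches, and a constant number of
   doublings restores the loss. *)
Lemma halving j rho U : U != set0 -> #|U| <= 2 ^ j -> 3 * #|U :\: V| <= #|T| ->
  4 * #|F| <= sigma * #|V| -> large (ball rho U) ->
  exists2 x, x \in U & large (ball (rho + tau * 5 * j) [set x]).
Proof.
move=> U0 Uj UV FV; elim: j rho U U0 Uj UV => [|j IH] rho U U0 Uj UV lU.
  have /eqP/cards1P[x Ux] : #|U| = 1 by apply/eqP; rewrite eqn_leq Uj card_gt0.
  by exists x; rewrite ?Ux ?inE // muln0 addn0 -Ux.
have [|U1 U1U cU1] := @sub_of_card _ U #|U|./2; first by lia.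
pose U2 := U :\: U1.
have cU : #|U| = #|U1| + #|U2| by rewrite -(cardsID U1 U) (setIidPr U1U).
have half2 : #|U1| <= 2 ^ j /\ #|U2| <= 2 ^ j.
  by move: Uj; rewrite expnS; lia.
have key (W : {set T}) : W \subset U -> #|W| <= 2 ^ j -> #|V| < 4 * #|ball rho W :&: V| ->
    exists2 x, x \in U & large (ball (rho + tau * 5 * j.+1) [set x]).
  move=> WU Wj lW; have bW0 : ball rho W != set0.
    by apply: contraTneq lW => ->; rewrite set0I cards0; lia.
  have W0 : W != set0.
    apply: contraNneq bW0 => ->; apply/eqP/setP => v; rewrite inE.
    elim: (rho) v => [|r IHr] v; first by rewrite inE.
    rewrite [ball _ _]/(grow _) in_grow IHr /=; apply/negbTE.
    by rewrite negb_and; apply/orP; right; apply/existsP => -[u]; rewrite IHr.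
  have WV : 3 * #|W :\: V| <= #|T|.
    by apply: leq_trans UV; rewrite leq_mul2l; apply/orP; right; apply/subset_leq_card/setSD.
  have le : #|ball rho W :&: V| <= #|ball rho W| by apply/subset_leq_card/subsetIl.
  (* The ball of [W] has more than [#|V| / 4], hence more than [#|T| / 16], vertices. This dominates
     [F], and five doublings suffice. *)
  have l1 : large (ball (tau * 5) (ball rho W)).
    apply: ball_doubling => //; first by rewrite ballDV.
      by nia.
    by lia.
  rewrite -ballD in l1; have [x xW lx] := IH _ _ W0 Wj WV l1.
  by exists x; rewrite ?(subsetP WU) // mulnS addnA.
have UE : U = U1 :|: U2.
  by apply/setP => v; rewrite !inE; case: (boolP (v \in U1)) => //= /(subsetP U1U).
have : #|ball rho U :&: V| <= #|ball rho U1 :&: V| + #|ball rho U2 :&: V|.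
  by rewrite [in leqLHS]UE ballU setIUl leq_card_setU.
move: lU; rewrite /large => lU le.
have [h|h] := ltnP #|V| (4 * #|ball rho U1 :&: V|).
  by apply: (key U1) => //; case: half2.
apply: (key U2); [exact: subsetDl|by case: half2|lia].
Qed.

(** [k] doublings make the ball of a whole set large; [k] halvings at five doublings each then
    isolate a single vertex. *)
Definition radius := tau * k + tau * 5 * k.

Definition bad := [set x | ~~ large (ball radius [set x])].

(** If the bad vertices were too many for [F], a set of them would have a large ball, and halving
    would find one bad vertex with a large ball. *)
Lemma card_bad : 4 * #|F| <= sigma * #|V| -> bad != set0 -> 2 < #|T| ->
  8 * #|V| <= 3 * #|T| -> sigma * #|bad| < #|F|.
Proof.
move=> FV bad0 n3 V8; rewrite ltnNge; apply/negP => Fbad.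
(* The bad set is trimmed to a third of the vertices. That third still dominates [F], as
   [4 * #|F| <= sigma * #|V|] and [#|V|] is at most 3/8 of [#|T|]. *)
have [U [UB U0 U3 FU]] : exists U : {set T},
    [/\ U \subset bad, U != set0, 3 * #|U| <= #|T| & #|F| <= sigma * #|U|].
  have [h|h] := leqP (3 * #|bad|) #|T|; first by exists bad.
  have [|U UB cU] := @sub_of_card _ bad (#|T| %/ 3); first by lia.
  exists U; split=> //; first by rewrite -card_gt0 cU; lia.
    by rewrite cU; lia.
  rewrite cU; have : 3 * #|T| <= 32 * (#|T| %/ 3) by lia.
  by move: FV V8; move: (_ %/ _) => m; nia.
have UV : 3 * #|U :\: V| <= #|T|.
  by apply: leq_trans U3; rewrite leq_mul2l subset_leq_card // subsetDl.
have lU : large (ball (tau * k) U).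
  apply: ball_doubling => //; apply: leq_trans nk _.
  by rewrite leq_pmulr // card_gt0.
have Uk : #|U| <= 2 ^ k by apply: leq_trans (ltnW nk); exact: max_card.
have [x xU lx] := halving U0 Uk UV FV lU.
by have := subsetP UB x xU; rewrite inE lx.
Qed.

Lemma good_connect x y : x \notin bad -> y \notin bad ->
  exists p : seq T, [/\ path (del_rel G F) x p, last x p = y, size p <= 2 * radius
    & all (fun v => (v \in V) || (v == y)) p].
Proof.
rewrite !inE !negbK => lx ly; have [w wV /andP[wx wy]] := large_meet lx ly.
have [p [pp lp sp Vp]] := ball_path wx; have [q [qp lq sq Vq]] := ball_path wy.
(* The walk from [y] is reversed without its end [w], which already ends [p]. *)
exists (p ++ rev (belast y q)); split.
- rewrite cat_path pp lp -lq rev_path /=.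
  by rewrite (@eq_path _ _ (del_rel G F)) // => a b; rewrite /= del_sym.
- rewrite last_cat lp; case: (q) lq => [/=->//|z q' _].
  by rewrite /= rev_cons last_rcons.
- by rewrite size_cat size_rev size_belast mul2n -addnn leq_add.
- rewrite all_cat all_rev; apply/andP; split; apply/allP => v.
    by move=> /(allP Vp) /= ->.
  by move=> /mem_belast; rewrite inE => /orP[/eqP->|/(allP Vq)/= ->//]; rewrite eqxx orbT.
Qed.

End Balls.

Lemma card_walk_edges (T : finType) (x : T) p : #|walk_edges x p| <= size p.
Proof.
rewrite /walk_edges cardsE; apply: leq_trans (card_size _) _.
by rewrite size_pairmap.
Qed.

Lemma path_walk_edges (T : finType) (e : rel T) (P : {set T} -> Prop) (x : T) p :
  path e x p -> (forall u v, e u v -> P [set u; v]) ->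
  forall f, f \in walk_edges x p -> P f.
Proof.
move=> pp eP f; rewrite inE; elim: p x pp => //= y p IH x /andP[xy yp].
by rewrite inE => /orP[/eqP->|fp]; [exact: eP|exact: IH yp fp].
Qed.

Section Routing.
Variables (T : finType) (G : sgraph T) (V : {set T}) (tau sigma k t : nat).
Hypotheses (tau0 : 0 < tau) (nk : #|T| < 2 ^ k) (V4 : #|T| <= 4 * #|V|)
  (V8 : 8 * #|V| <= 3 * #|T|) (n3 : 2 < #|T|).
Hypothesis expV : forall (A : {set T}) (F : {set {set T}}), A != set0 ->
  3 * #|A :\: V| <= #|T| -> 2 * #|A :&: V| <= #|V| -> #|F| <= sigma * #|A| ->
  #|A| <= tau * #|V :&: nbhd (del_edges G F) A|.
Let l := 2 * radius tau k.
Hypothesis lts : 32 * l * t <= sigma.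

(** Haxell's condition holds for the edge sets of short walks: if [#|F| <= 2 * l * #|J|], the bad
    vertices are so few that, with at most [t] demands each, they miss some demand of [J], whose
    ends are then connected outside [F]. *)
Lemma route_demands (I : finType) (src dst : I -> T) :
  (forall v, #|[set i | (src i == v) || (dst i == v)]| <= t) ->
  exists W : I -> seq T,
    (forall i, [/\ path (adj G) (src i) (W i), last (src i) (W i) = dst i,
       size (W i) <= l & all (fun v => (v \in V) || (v == dst i)) (W i)]) /\
    (forall i j, i != j ->
       [disjoint walk_edges (src i) (W i) & walk_edges (src j) (W j)]).
Proof.
move=> degt.
pose ok i (p : seq T) := [/\ path (adj G) (src i) p, last (src i) p = dst i,
       size p <= l & all (fun v => (v \in V) || (v == dst i)) p].
pose valid i (S : {set {set T}}) := exists2 p, ok i p & S = walk_edges (src i) p.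
have bnd (J : {set I}) (B : {set T}) :
    (forall i, i \in J -> (src i \in B) || (dst i \in B)) -> #|J| <= t * #|B|.
  move=> JB; apply: (@leq_trans #|\bigcup_(v in B) [set i | (src i == v) || (dst i == v)]|).
    apply/subset_leq_card/subsetP => i /JB /orP[] h; apply/bigcupP.
      by exists (src i); rewrite // inE eqxx.
    by exists (dst i); rewrite // inE eqxx orbT.
  apply: leq_trans (card_bigcup_leq _ _) _; rewrite mulnC -sum_nat_const.
  exact: leq_sum.
have [||f [vf df]] := @haxell_system I {set T} valid l.
- by move=> i S [p [_ _ sp _] ->]; apply: leq_trans sp; exact: card_walk_edges.
- move=> J F J0 FJ.
  have Jn : #|J| <= t * #|T|.
    by have := bnd J setT; rewrite cardsT; apply=> i _; rewrite inE.
  have FV : 4 * #|F| <= sigma * #|V|.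
    have : 4 * #|F| <= 8 * l * (t * #|T|).
      by apply: (@leq_trans (8 * l * #|J|)); [lia|rewrite leq_mul2l Jn orbT].
    have : 32 * l * t * #|V| <= sigma * #|V| by rewrite leq_mul2r lts orbT.
    have : 8 * l * t * #|T| <= 8 * l * t * (4 * #|V|) by rewrite leq_mul2l V4 orbT.
    move: (l * t) => lt; lia.
  pose Bd := bad G V F tau k.
  have [i iJ iB] : exists2 i, i \in J & (src i \notin Bd) && (dst i \notin Bd).
    have [|/subsetPn[i iJ]] := boolP (J \subset [set i | (src i \in Bd) || (dst i \in Bd)]); last first.
      by rewrite inE negb_or; exists i.
    move=> /subsetP JB; have : #|J| <= t * #|Bd|.
      by apply: bnd => i /JB; rewrite inE.
    have Jpos : 0 < #|J| by rewrite card_gt0.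
    have [->|B0] := eqVneq Bd set0; first by rewrite cards0 muln0; lia.
    have := card_bad tau0 nk V4 (fun A => @expV A F) FV B0 n3 V8.
    rewrite -/Bd => h1 h2; exfalso.
    have : 32 * l * t * #|Bd| <= sigma * #|Bd| by rewrite leq_mul2r lts orbT.
    have : l * #|J| <= l * (t * #|Bd|) by rewrite leq_mul2l h2 orbT.
    by move: h1 FJ; move: (l) #|Bd| #|J| #|F| => ll b j f; nia.
  exists i => //; have /andP[iB1 iB2] := iB.
  have [p [pp lp sp Vp]] := good_connect iB1 iB2.
  exists (walk_edges (src i) p).
    exists p => //; split=> //; apply: sub_path pp => u v /andP[] //.
  rewrite disjoint_subset; apply/subsetP => e ep; rewrite inE.
  by apply: (path_walk_edges (P := fun e => e \notin F) pp _ ep) => u v /andP[].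
have /choice[W WP] : forall i, exists p, ok i p /\ f i = walk_edges (src i) p.
  by move=> i; have [p okp fp] := vf i; exists p.
exists W; split=> [i|i j ij]; first by case: (WP i).
by have [_ <-] := WP i; have [_ <-] := WP j; exact: df.
Qed.

End Routing.

(** * Embedding a network *)

Lemma inr_inj (A B : Type) : injective (@inr A B).
Proof. by move=> a b []. Qed.

Lemma ex_injective (A B : finType) : #|A| <= #|B| -> exists f : A -> B, injective f.
Proof.
move=> AB; exists (fun a => enum_val (widen_ord AB (enum_rank a))) => a a'.
by move=> /enum_val_inj/(congr1 val)/= /val_inj/enum_rank_inj.
Qed.

Lemma ex_balanced_map (A T : finType) (V : {set T}) m : #|A| <= #|V| * m ->
  exists2 f : A -> T, forall a, f a \in V & forall v, #|[set a | f a == v]| <= m.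
Proof.
move=> AV; have [|f f_inj] := @ex_injective A ({x | x \in V} * 'I_m)%type.
  by rewrite card_prod card_sig card_ord.
exists (fun a => val (f a).1) => [a|v]; first exact: valP.
rewrite -[leqRHS]card_ord -(@card_in_imset _ _ (fun a => (f a).2)) ?max_card //.
move=> a b; rewrite !inE => /eqP av /eqP bv ab; apply: f_inj.
rewrite (surjective_pairing (f a)) (surjective_pairing (f b)) ab.
by congr (_, _); apply: val_inj; rewrite av bv.
Qed.

(** Exchanging each [s j] with [t j] and fixing all else is an involution. It extends a pairing of
    terminals to a permutation that the network can route. *)
Lemma ex_swap (J X : finType) (s t : J -> X) : injective s -> injective t ->
  (forall i j, s i != t j) -> exists2 f : X -> X, injective f & forall j, f (s j) = t j.
Proof.
move=> s_inj t_inj st.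
pose f r := if [pick j | s j == r] is Some j then t j else
            if [pick j | t j == r] is Some j then s j else r.
have fs j : f (s j) = t j.
  by rewrite /f; case: pickP => [i /eqP/s_inj-> //|/(_ j)]; rewrite eqxx.
have ft j : f (t j) = s j.
  rewrite /f; case: pickP => [i|_]; first by rewrite (negbTE (st _ _)).
  by case: pickP => [i /eqP/t_inj-> //|/(_ j)]; rewrite eqxx.
exists f => //; apply: inv_inj => r.
have [/existsP[j /eqP<-]|rs] := boolP [exists j, s j == r]; first by rewrite fs ft.
have [/existsP[j /eqP<-]|rt] := boolP [exists j, t j == r]; first by rewrite ft fs.
have -> : f r = r.
  rewrite /f; case: pickP => [j sj|_]; first by case/existsP: rs; exists j.
  by case: pickP => // j tj; case/existsP: rt; exists j.
rewrite /f; case: pickP => [j sj|_]; first by case/existsP: rs; exists j.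
by case: pickP => // j tj; case/existsP: rt; exists j.
Qed.

Lemma walk_edges_cat (T : finType) (x : T) p q :
  walk_edges x (p ++ q) = walk_edges x p :|: walk_edges (last x p) q.
Proof.
apply/setP => e; rewrite !inE; elim: p x => //= y p IH x.
by rewrite !inE IH orbA.
Qed.

Lemma path_of_walk_edges (T : finType) (E : {set {set T}}) (x : T) p :
  walk_edges x p \subset E -> path (fun u v => [set u; v] \in E) x p.
Proof.
move=> /subsetP pE; have {pE} : forall e, e \in pairmap (fun u v => [set u; v]) x p -> e \in E.
  by move=> e ep; apply: pE; rewrite inE.
elim: p x => //= y p IH x pE; rewrite pE ?mem_head // IH // => e ep.
by apply: pE; rewrite inE ep orbT.
Qed.

Lemma shorten_walk (T : finType) (x : T) p : exists q : seq T,
  [/\ last x q = last x p, uniq (x :: q), {subset q <= p}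
    & walk_edges x q \subset walk_edges x p].
Proof.
have := path_of_walk_edges (subxx (walk_edges x p)).
move=> /shortenP[q qp uq sub]; exists q; split=> //.
by apply/subsetP => e; apply: (path_walk_edges (P := fun e => e \in walk_edges x p) qp).
Qed.

Lemma loop_notin_edges (T : finType) (G : sgraph T) (u : T) : [set u; u] \notin edges G.
Proof.
apply/negP => /imsetP[[a b]]; rewrite inE /= => ab e.
have : a \in [set u; u] by rewrite e set21.
have : b \in [set u; u] by rewrite e set22.
by rewrite !inE !orbb => /eqP bu /eqP au; move: ab; rewrite au bu adj_irrefl.
Qed.

Section EdgeSubgraph.
Variables (T : finType) (G : sgraph T) (E : {set {set T}}).
Hypothesis EG : E \subset edges G.

Definition edge_rel : rel T := fun u v => [set u; v] \in E.

Lemma edge_rel_sym : symmetric edge_rel.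
Proof. by move=> u v; rewrite /edge_rel setUC. Qed.

Lemma edge_rel_irrefl : irreflexive edge_rel.
Proof.
by move=> u; apply: contraNF (loop_notin_edges G u) => uE; apply: (subsetP EG).
Qed.

Definition edge_subgraph := SGraph edge_rel_sym edge_rel_irrefl.

Lemma edges_edge_subgraph : edges edge_subgraph = E.
Proof.
apply/setP => e; apply/imsetP/idP => [[z]|eE].
  by rewrite inE => zE ->.
have /imsetP[z _ ez] := subsetP EG e eE.
by exists z; rewrite // inE /= /edge_rel -ez.
Qed.

End EdgeSubgraph.

Section Concatenation.
Variables (T I : finType) (G : sgraph T) (V : {set T}) (src dst : I -> T) (l : nat).
Variable W : I -> seq T.
Hypothesis WP : forall i, [/\ path (adj G) (src i) (W i), last (src i) (W i) = dst i,
  size (W i) <= l & all (fun v => (v \in V) || (v == dst i)) (W i)].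

Fixpoint chain x (D : seq I) y : Prop :=
  if D is i :: D' then src i = x /\ chain (dst i) D' y else x = y.

Lemma chain_cat x D z D' y : chain x D z -> chain z D' y -> chain x (D ++ D') y.
Proof. by elim: D x => [x /= -> //|i D IH x /= [-> h] /(IH _ h)]. Qed.

Definition concat (D : seq I) := flatten (map W D).

Lemma concatP x D y : chain x D y ->
  [/\ last x (concat D) = y, size (concat D) <= l * size D,
      forall v, v \in concat D -> v \in V \/ exists2 i, i \in D & v = dst i
    & forall e, e \in walk_edges x (concat D) ->
        exists2 i, i \in D & e \in walk_edges (src i) (W i)].
Proof.
elim: D x => [x /= ->|i D IH x /= [<- /IH[ld sd Vd ed]]].
  by split=> // e; rewrite inE.
have [_ li si Vi] := WP i; rewrite /concat /= -/(concat D); split.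
- by rewrite last_cat li.
- by rewrite size_cat mulnS leq_add.
- move=> v; rewrite mem_cat => /orP[/(allP Vi)/orP[|/eqP->]|/Vd[|[j jD ->]]].
  + by left.
  + by right; exists i; rewrite ?mem_head.
  + by left.
  + by right; exists j; rewrite // inE jD orbT.
- move=> e; rewrite walk_edges_cat inE => /orP[ei|].
    by exists i; rewrite ?mem_head.
  by rewrite li => /ed[j jD ej]; exists j; rewrite // inE jD orbT.
Qed.

End Concatenation.

(** Every vertex owns two terminals and occurs in at most two pairs, so each occurrence gets a
    terminal of its own. *)
Lemma ex_ports (T : finType) (P : seq {set T}) :
  all (fun e : {set T} => #|e| == 2) P ->
  (forall v : T, count (fun e : {set T} => v \in e) P <= 2) ->
  exists s u : 'I_(size P) -> T * bool,
    [/\ forall j : 'I_(size P), nth set0 P j = [set (s j).1; (u j).1], injective s, injective u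
      & forall i j, s i != u j].
Proof.
move=> P2 Pcount.
have /choice[xy xyP] : forall j : 'I_(size P), exists z : T * T,
    nth set0 P j = [set z.1; z.2] /\ z.1 != z.2.
  move=> j.
  have /cards2P[x [y [xy ->]]] : #|nth set0 P j| == 2 by apply: (allP P2) (mem_nth _ _).
  by exists (x, y).
(* Whether [v] already occurred in an earlier pair. *)
pose turn (v : T) (j : 'I_(size P)) := 0 < count (fun e : {set T} => v \in e) (take j P).
have turnP (v : T) (i j : 'I_(size P)) : v \in nth set0 P i -> v \in nth set0 P j -> turn v i = turn v j -> i = j.
  have lt_turn (a b : 'I_(size P)) : a < b -> v \in nth set0 P a -> v \in nth set0 P b ->
      turn v a = turn v b -> False.
    move=> ab va vb; have ca : count (fun e : {set T} => v \in e) (take a.+1 P) =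
        count (fun e : {set T} => v \in e) (take a P) + 1.
      by rewrite (take_nth set0) // -cats1 count_cat /= va.
    have cb : count (fun e : {set T} => v \in e) (take b.+1 P) =
        count (fun e : {set T} => v \in e) (take b P) + 1.
      by rewrite (take_nth set0) // -cats1 count_cat /= vb.
    have mono m m' : m <= m' -> count (fun e : {set T} => v \in e) (take m P) <=
        count (fun e : {set T} => v \in e) (take m' P).
      by move=> mm; rewrite -(subnKC mm) takeD count_cat leq_addr.
    have := mono _ _ ab; have := Pcount v.
    rewrite -[P in count _ P](cat_take_drop b.+1) count_cat /turn ca cb.
    by move: (count _ _) (count _ _) (count _ _) => p q r; case: p; case: q; lia.
  move=> vi vj e; have [ij|ji|/val_inj//] := ltngtP i j.
    by case: (lt_turn i j).
  by case: (lt_turn j i).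
pose s (j : 'I_(size P)) := ((xy j).1, turn (xy j).1 j).
pose u (j : 'I_(size P)) := ((xy j).2, turn (xy j).2 j).
have sm j : (xy j).1 \in nth set0 P j by have [-> _] := xyP j; rewrite set21.
have um j : (xy j).2 \in nth set0 P j by have [-> _] := xyP j; rewrite set22.
have s_inj : injective s.
  by move=> i j [e ti]; apply: (turnP (xy i).1 i j (sm i)); [rewrite e sm|rewrite ti e].
have u_inj : injective u.
  by move=> i j [e ti]; apply: (turnP (xy i).2 i j (um i)); [rewrite e um|rewrite ti e].
have su i j : s i != u j.
  apply/eqP => -[e ti]; have ij : i = j.
    by apply: (turnP (xy i).1 i j (sm i)); [rewrite e um|rewrite ti e].
  by have [_] := xyP j; rewrite -{1}ij e eqxx.
by exists s, u; split=> // j; have [] := xyP j.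
Qed.

Section Network.
Variables (T : finType) (G : sgraph T) (V : {set T}) (l t d : nat).
Hypothesis route : forall (I : finType) (src dst : I -> T),
  (forall v, #|[set i | (src i == v) || (dst i == v)]| <= t) ->
  exists W : I -> seq T,
    (forall i, [/\ path (adj G) (src i) (W i), last (src i) (W i) = dst i,
       size (W i) <= l & all (fun v => (v \in V) || (v == dst i)) (W i)]) /\
    (forall i j, i != j ->
       [disjoint walk_edges (src i) (W i) & walk_edges (src j) (W j)]).
Hypotheses (portd : 2 * #|T| <= 2 ^ d) (V16 : 2 ^ d <= #|V| * 16)
  (td : 36 + 32 * d.*2.+1 <= t).

Lemma network_connected : exists H : sgraph T,
  [/\ subgraph H G, #|edges H| <= l * (4 * #|T| + d.*2.+1 * 2 ^ d)
    & forall P : seq {set T}, all (fun e : {set T} => #|e| == 2) P ->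
      (forall v : T, count (fun e : {set T} => v \in e) P <= 2) ->
      exists Q : 'I_(size P) -> T * seq T,
        (forall i : 'I_(size P), path_through H V (nth set0 P i) (Q i).1 (Q i).2 /\
           size (Q i).2 <= l * d.*2.+2) /\
        (forall i j : 'I_(size P), i != j ->
           [disjoint walk_edges (Q i).1 (Q i).2 & walk_edges (Q j).1 (Q j).2])].
Proof.
have [X [c [cX c_inj rearr]]] := benes_network d.
have [|phi phiV phi16] := @ex_balanced_map X T V 16; first by rewrite cX.
have [|port port_inj] := @ex_injective (T * bool)%type X.
  by rewrite card_prod card_bool cX mulnC.
(* The demands: a link from each terminal's vertex to its switch, a link back, and the crossings of
   every stage. There are [d.*2] stages; the successor makes [inord] available for indexing them. *)
pose K : finType := ((T * bool) + (T * bool) + ('I_(d.*2.+1) * X))%type.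
pose src (i : K) := match i with
  | inl (inl a) => a.1 | inl (inr a) => phi (port a) | inr (_, r) => phi r end.
pose dst (i : K) := match i with
  | inl (inl a) => phi (port a) | inl (inr a) => a.1 | inr (m, r) => phi (c m r) end.
have cT1 v : #|[set a : T * bool | a.1 == v]| <= 2.
  rewrite -card_bool -(@card_in_imset _ _ snd) ?max_card // => a b.
  rewrite !inE => /eqP av /eqP bv ab.
  by rewrite (surjective_pairing a) (surjective_pairing b) av bv ab.
have cP v : #|[set a : T * bool | phi (port a) == v]| <= 16.
  apply: leq_trans (phi16 v); rewrite -(card_imset _ port_inj).
  by apply/subset_leq_card/subsetP => r /imsetP[a]; rewrite !inE => av ->.
have cC (g : nat -> X -> X) v : (forall m, injective (g m)) ->
    #|[set i : 'I_(d.*2.+1) * X | phi (g i.1 i.2) == v]| <= 16 * d.*2.+1.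
  move=> g_inj; rewrite -[d.*2.+1 in leqRHS]card_ord mulnC -cardsT.
  apply: leq_trans (leq_mul (leqnn _) (phi16 v)); rewrite -cardsX.
  rewrite -(@card_in_imset _ _ (fun i : 'I_(d.*2.+1) * X => (i.1, g i.1 i.2))).
    apply/subset_leq_card/subsetP => z /imsetP[i]; by rewrite !inE => e ->.
  move=> [m r] [m' r'] _ _ /= e; have em : m = m' := congr1 fst e.
  by have := congr1 snd e; rewrite /= -em => /g_inj ->.
(* Links in and links out meet [v] at most 2 + 16 times each, crossings at most [16 * d.*2.+1] times
   at either end. *)
have [v|W [WP Wd]] := @route K src dst.
  pose A1 := [set a : T * bool | a.1 == v].
  pose A2 := [set a : T * bool | phi (port a) == v].
  pose A3 := [set i : 'I_(d.*2.+1) * X | phi i.2 == v].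
  pose A4 := [set i : 'I_(d.*2.+1) * X | phi (c i.1 i.2) == v].
  have le3 := cC (fun _ => id) v (fun _ _ _ e => e).
  have le4 := cC c v c_inj.
  have le (D : finType) (h : D -> K) (B : {set D}) : #|h @: B| <= #|B|.
    exact: leq_imset_card.
  apply: leq_trans td.
  apply: (@leq_trans #|((fun a => inl (inl a)) @: (A1 :|: A2) :|:
     (fun a => inl (inr a)) @: (A1 :|: A2)) :|: inr @: (A3 :|: A4) : {set K}|).
    apply/subset_leq_card/subsetP => -[[a|a]|[m r]]; rewrite !inE /= => h;
      apply/orP; [left; apply/orP; left|left; apply/orP; right|right];
      apply/imsetP.
    - by exists a; rewrite // !inE.
    - by exists a; rewrite // !inE orbC.
    - by exists (m, r); rewrite // !inE.
  have u1 := leq_card_setU A1 A2; have u2 := leq_card_setU A3 A4.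
  have := cT1 v; have := cP v; rewrite -/A1 -/A2 => p1 p2.
  apply: leq_trans (leq_card_setU _ _) _.
  apply: leq_trans (leq_add (leq_card_setU _ _) (le _ _ _)) _.
  apply: leq_trans (leq_add (leq_add (le _ _ _) (le _ _ _)) (leqnn _)) _.
  move: u1 u2 => [u1 _] [u2 _].
  move: le3 le4 p1 p2 u1 u2; rewrite /= -/A3 -/A4; lia.
pose E := \bigcup_(i in [set: K]) walk_edges (src i) (W i).
have EG : E \subset edges G.
  apply/bigcupsP => i _; apply/subsetP => e; have [Wi _ _ _] := WP i.
  apply: (path_walk_edges (P := fun e => e \in edges G) Wi) => u v uv.
  by apply/imsetP; exists (u, v); rewrite ?inE.
exists (edge_subgraph EG); split.
- by rewrite /subgraph edges_edge_subgraph.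
- rewrite edges_edge_subgraph; apply: leq_trans (card_bigcup_leq _ _) _.
  apply: (@leq_trans (\sum_(i in [set: K]) l)).
    apply: leq_sum => i _; have [_ _ Wi _] := WP i.
    exact: leq_trans (card_walk_edges _ _) Wi.
  rewrite sum_nat_const cardsT mulnC leq_mul2l; apply/orP; right.
  rewrite /K !card_sum !card_prod card_bool card_ord cX; lia.
move=> P P2 Pcount.
have [s [u [suP s_inj u_inj su]]] := ex_ports P2 Pcount.
have [||i j|f f_inj fP] := @ex_swap _ _ (fun j => port (s j)) (fun j => port (u j)).
- by move=> i j /port_inj/s_inj.
- by move=> i j /port_inj/u_inj.
- by rewrite (inj_eq port_inj).
have [pos [pos0 posm pos_inj pos_step]] := rearr f f_inj.
pose cross m r : K := inr (inord m, pos m r).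
(* A packet that keeps its place at a stage uses no demand there. *)
pose steps m r := flatten [seq if pos i.+1 r == pos i r then [::] else [:: cross i r] | i <- iota 0 m].
have stepsS m r : steps m.+1 r = steps m r ++
    (if pos m.+1 r == pos m r then [::] else [:: cross m r]).
  by rewrite /steps -[X in iota 0 X]addn1 iotaD map_cat flatten_cat /= cats0.
have steps_chain m r : m <= d.*2 -> chain src dst (phi r) (steps m r) (phi (pos m r)).
  elim: m => [|m IH] mh; first by rewrite /steps /= pos0.
  rewrite stepsS; apply: chain_cat (IH (ltnW mh)) _.
  case: eqP => [-> //|ne] /=; split=> //; rewrite inordK; last by lia.
  by case: (pos_step m r mh) => // ->.
have steps_size m r : size (steps m r) <= m.
  elim: m => // m IH; rewrite stepsS size_cat -addn1 leq_add //.
  by case: ifP.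
have steps_mem m r i : m <= d.*2 -> i \in steps m r -> exists2 h : 'I_(d.*2.+1), True & i = inr (h, pos h r).
  elim: m => // m IH mh; rewrite stepsS mem_cat => /orP[/IH|]; first by apply; lia.
  case: ifP => // _; rewrite inE => /eqP->; exists (inord m) => //.
  by rewrite /cross inordK //; lia.
pose D j : seq K := inl (inl (s j)) :: steps d.*2 (port (s j)) ++ [:: inl (inr (u j))].
have D_chain j : chain src dst (s j).1 (D j) (u j).1.
  split=> //=; apply: chain_cat (steps_chain _ _ (leqnn _)) _.
  by rewrite posm fP.
have D_size j : size (D j) <= d.*2.+2.
  by rewrite /= size_cat /= addn1 !ltnS.
have D_mem j i : i \in D j -> [\/ i = inl (inl (s j)), i = inl (inr (u j))
    | exists h : 'I_(d.*2.+1), i = inr (h, pos h (port (s j)))].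
  rewrite inE mem_cat inE => /orP[/eqP->|/orP[/(steps_mem _ _ _ (leqnn _))[h _ ->]|/eqP->]].
  - by constructor 1.
  - by constructor 3; exists h.
  - by constructor 2.
(* Distinct pairs own distinct terminals, and at every stage their packets are at distinct
   places. *)
have D_disj i j a : a \in D i -> a \in D j -> i = j.
  move=> /D_mem[->|->|[h ->]] /D_mem[||[h']] //.
  - by case; exact: s_inj.
  - by case; exact: u_inj.
  - move=> e0; have e := inr_inj e0; have e1 : h = h' := congr1 fst e.
    have /= := congr1 snd e; rewrite -e1 => /pos_inj/port_inj; exact: s_inj.
have D_dst j i : i \in D j -> dst i \in V \/ dst i = (u j).1.
  by move=> /D_mem[->|->|[h ->]]; [left|right|left]; rewrite //= phiV.
have Q_ex (j : 'I_(size P)) : exists q : seq T,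
    [/\ path_through (edge_subgraph EG) V (nth set0 P j) (s j).1 q,
        size q <= l * d.*2.+2
      & forall e, e \in walk_edges (s j).1 q ->
        exists2 i, i \in D j & e \in walk_edges (src i) (W i)].
  have [lw sw Vw ew] := concatP WP (D_chain j).
  have [q [lq uq qw eq]] := shorten_walk (s j).1 (concat W (D j)).
  exists q; split.
  - apply/and4P; split=> //.
    + apply: (path_of_walk_edges (E := E)); apply: subset_trans eq _.
      by apply/subsetP => e /ew[i _ ei]; apply/bigcupP; exists i; [rewrite inE|exact: ei].
    + by rewrite suP lq lw.
    (* A demand may end outside [V] only if it is the final link out. Its end is the last vertex of
       the path, hence not internal. *)
    + rewrite /internal; case: q lq uq qw {eq} => // z q lq uq qw /=.
      apply/allP => v vq; have vzq : v \in z :: q by exact: mem_belast vq.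
      have vN : v != (u j).1.
        apply: contraTneq vq => ->; rewrite -lw -lq /=.
        by move: uq => /= /andP[_]; rewrite -/(uniq (z :: q)) lastI rcons_uniq => /andP[].
      case: (Vw v (qw v vzq)) => // -[i iD vi].
      by have [dV|de] := D_dst j i iD; [rewrite vi|rewrite vi de eqxx in vN].
  - apply: leq_trans (_ : size (concat W (D j)) <= _).
      by apply: uniq_leq_size => //; case/andP: uq.
    by apply: leq_trans sw _; rewrite leq_mul2l D_size orbT.
  - by move=> e /(subsetP eq); exact: ew.
have [q qP] := choice Q_ex.
exists (fun j => ((s j).1, q j)); split=> [j|i j ij].
  by have [] := qP j.
have [_ _ ei] := qP i; have [_ _ ej] := qP j.
rewrite disjoint_subset; apply/subsetP => e /= /ei[a aD ea]; rewrite inE.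
apply/negP => /ej[b bD eb]; have ab : a != b.
  by apply: contraNneq ij => e'; rewrite (D_disj i j a) // e'.
have := Wd a b ab; rewrite disjoint_subset => /subsetP/(_ e ea).
by rewrite inE eb.
Qed.

End Network.

(** * Choice of the parameters *)

Section Constants.
Variables k tau : nat.
Hypotheses (hk : 2 ^ 32 <= k) (tauE : tau = 2 ^ 25 * k ^ 4).

(** Every spare power of [k] absorbs a factor [2 ^ 32]. *)
Lemma pow_absorb a b c : b <= c -> a <= 32 * (c - b) -> 2 ^ a * k ^ b <= k ^ c.
Proof.
move=> bc ac; rewrite -[in leqRHS](subnK bc) expnD leq_mul2r; apply/orP; right.
apply: (@leq_trans ((2 ^ 32) ^ (c - b))); first by rewrite -expnM leq_exp2l.
by case: (c - b) => // m; rewrite leq_exp2r.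
Qed.

Let E := 2 ^ 9 * k ^ 2.

Lemma k_gt0 : 0 < k.
Proof. by apply: leq_trans hk; rewrite expn_gt0. Qed.

Lemma k_ge1000 : 1000 < k.
Proof. by apply: leq_trans hk; apply: (@leq_trans (2 ^ 10)) => //; rewrite leq_exp2l. Qed.

Lemma E_sq_le : E * E.+1 <= 2 ^ 19 * k ^ 4.
Proof.
have -> : 2 ^ 19 * k ^ 4 = E * (2 * E).
  by rewrite /E -[19]/(9 + (1 + 9)) -[4]/(2 + 2) !expnD expn1; ring.
have E0 : 0 < E by rewrite /E muln_gt0 !expn_gt0 k_gt0.
by rewrite leq_mul2l; apply/orP; right; lia.
Qed.

Lemma param_sigma : 10 * (k ^ 9).+1 < 3 * k ^ 10.
Proof.
rewrite (expnS _ 9); have : 0 < k ^ 9 by rewrite expn_gt0 k_gt0.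
have := k_ge1000; move: (k ^ 9) => m; nia.
Qed.

Lemma param_star : 4 * k ^ 16 * k ^ 15 * k ^ 10 <= k ^ 135.
Proof.
have -> : 4 * k ^ 16 * k ^ 15 * k ^ 10 = 2 ^ 2 * k ^ 41.
  by rewrite -[41]/(16 + (15 + 10)) !expnD; ring.
exact: pow_absorb.
Qed.

Lemma param_theta : tau * k ^ 9 <= k ^ 15.
Proof.
rewrite tauE.
have -> : 2 ^ 25 * k ^ 4 * k ^ 9 = 2 ^ 25 * k ^ 13.
  by rewrite -[13]/(4 + 9) expnD; ring.
exact: pow_absorb.
Qed.

Lemma param_Q : 2 * k ^ 10 * (E * E.+1) <= k ^ 16.
Proof.
apply: leq_trans (leq_mul (leqnn _) E_sq_le) _.
have -> : 2 * k ^ 10 * (2 ^ 19 * k ^ 4) = 2 ^ 20 * k ^ 14.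
  by rewrite (expnS 2 19) -[14]/(10 + 4) expnD; ring.
exact: pow_absorb.
Qed.

Lemma param_tau : 64 * (E * E.+1) <= tau.
Proof.
rewrite tauE; apply: leq_trans (leq_mul (leqnn _) E_sq_le) _.
by rewrite -[25]/(6 + 19) expnD mulnA.
Qed.

Lemma param_S : 4 * k ^ 16 * k ^ 15 * (16 * (E * E.+1) * k ^ 10) < k ^ 135.
Proof.
apply: (@leq_ltn_trans (4 * k ^ 16 * k ^ 15 * (16 * (2 ^ 19 * k ^ 4) * k ^ 10))).
  rewrite leq_mul2l; apply/orP; right; rewrite leq_mul2r; apply/orP; right.
  by rewrite leq_mul2l E_sq_le orbT.
have -> : 4 * k ^ 16 * k ^ 15 * (16 * (2 ^ 19 * k ^ 4) * k ^ 10) = 2 ^ 25 * k ^ 45.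
  by rewrite -[25]/(2 + (4 + 19)) -[45]/(16 + (15 + (4 + 10))) !expnD; ring.
apply: (@leq_ltn_trans (k ^ 134)); first exact: pow_absorb.
by rewrite ltn_exp2l //; apply: leq_trans k_ge1000.
Qed.

(** [k.+1] because there are fewer than [2 ^ k.+1] vertices; two radii because the balls around both
    ends meet. *)
Definition walk_bound := 2 * radius tau k.+1.

Lemma walk_bound_le : walk_bound <= 2 ^ 30 * k ^ 5.
Proof.
have -> : 2 ^ 30 * k ^ 5 = (2 ^ 25 * k ^ 4) * (32 * k).
  by rewrite -[30]/(25 + 5) (expnS k 4) expnD; ring.
rewrite -tauE /walk_bound /radius; have := k_ge1000; nia.
Qed.

Lemma param_route : 32 * walk_bound * k ^ 2 <= k ^ 9.
Proof.
apply: (@leq_trans (2 ^ 35 * k ^ 7)); last exact: pow_absorb.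
have -> : 2 ^ 35 * k ^ 7 = 32 * (2 ^ 30 * k ^ 5) * k ^ 2.
  by rewrite -[35]/(5 + 30) -[7]/(5 + 2) !expnD; ring.
by rewrite leq_mul2r leq_mul2l walk_bound_le !orbT.
Qed.

Lemma param_degree : 36 + 32 * k.+2.*2.+1 <= k ^ 2.
Proof. by have := k_ge1000; rewrite expnS expn1; nia. Qed.

Lemma edge_bound n : 2 ^ k <= n ->
  walk_bound * (4 * n + k.+2.*2.+1 * 2 ^ k.+2) <= 2 ^ 9 * n * k ^ 10.
Proof.
move=> kn; apply: (@leq_trans (2 ^ 30 * k ^ 5 * (16 * k * n))).
  apply: leq_mul walk_bound_le _; rewrite !expnS.
  have := k_ge1000; move: (2 ^ k) kn => m; nia.
have -> : 2 ^ 30 * k ^ 5 * (16 * k * n) = n * (2 ^ 34 * k ^ 6).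
  by rewrite -[34]/(30 + 4) (expnS k 5) expnD; ring.
rewrite (mulnC _ n) -mulnA leq_mul2l; apply/orP; right.
apply: leq_trans (pow_absorb _ _ : _ <= k ^ 10) _ => //.
by rewrite leq_pmull // expn_gt0.
Qed.

Lemma path_bound : walk_bound * k.+2.*2.+2 <= k ^ 7.
Proof.
apply: (@leq_trans (2 ^ 30 * k ^ 5 * (4 * k))).
  by apply: leq_mul walk_bound_le _; have := k_ge1000; lia.
have -> : 2 ^ 30 * k ^ 5 * (4 * k) = 2 ^ 32 * k ^ 6.
  by rewrite -[32]/(30 + 2) (expnS k 5) expnD; ring.
exact: pow_absorb.
Qed.

(** Expansion is used with [S = k^135], [Lam = k^10], [theta = k^15], [Q = k^16], [sigma = k^9] and
    [tau = 2^25 k^4], routing with degree bound [k^2]. *)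
Lemma connected_subgraph (R : reals.Real.type) (T : finType) (G : sgraph T) (V : {set T}) :
  2 ^ k <= #|T| < 2 ^ k.+1 -> robust_expander G E (k ^ 135) ->
  #|T| <= 4 * #|V| -> 8 * #|V| <= 3 * #|T| ->
  fair (k ^ 10) V (nbhd G) -> fair (k ^ 10) V (popular G (k ^ 15)) ->
  fair (k ^ 10) V (fun A => heavy G (k ^ 135) (popular G (k ^ 15) A)) ->
  exists H : sgraph T,
  [/\ subgraph H G, #|edges H| <= 2 ^ 9 * #|T| * k ^ 10
    & forall P : seq {set T}, all (fun e : {set T} => #|e| == 2) P ->
      (forall v : T, count (fun e : {set T} => v \in e) P <= 2) ->
      exists Q : 'I_(size P) -> T * seq T,
        (forall i : 'I_(size P), path_through H V (nth set0 P i) (Q i).1 (Q i).2 /\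
           size (Q i).2 <= k ^ 7) /\
        (forall i j : 'I_(size P), i != j ->
           [disjoint walk_edges (Q i).1 (Q i).2 & walk_edges (Q j).1 (Q j).2])].
Proof.
move=> /andP[kn nk] expG V4 V8 fN fP fH.
have nth : 2 * #|T| < 2 ^ (k ^ 15).
  apply: (@leq_trans (2 ^ k.+2)); first by rewrite (expnS _ k.+1) ltn_pmul2l.
  rewrite leq_exp2l //; apply: leq_trans (_ : k ^ 2 <= _).
    by have := k_ge1000; rewrite expnS expn1; nia.
  by rewrite leq_exp2l //; apply: leq_trans k_ge1000.
have expV A F := @expansion_through T G E (k ^ 135) (k ^ 10) (k ^ 15) (k ^ 16)
  tau (k ^ 9) expG param_sigma param_star nth param_theta param_Q
  param_tau param_S R V V8 fN fP fH A F.
have tau0 : 0 < tau by rewrite tauE muln_gt0 !expn_gt0 k_gt0.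
have n3 : 2 < #|T|.
  by apply: leq_trans kn; apply: leq_trans (ltn_expl k _); rewrite ?ltnS //; have := k_ge1000; lia.
have route := @route_demands T G V tau (k ^ 9) k.+1 (k ^ 2) tau0 nk V4 V8 n3
  expV param_route.
(* [d = k.+2] gives at least two terminals per vertex, and [2 ^ k.+2] is at most four times [#|T|],
   hence at most 16 times [#|V|]. *)
have [|||H [HG HE HP]] := @network_connected T G V walk_bound (k ^ 2) k.+2 route.
- by rewrite expnS leq_mul2l ltnW.
- rewrite !expnS; lia.
- exact: param_degree.
exists H; split=> //; first exact: leq_trans HE (edge_bound kn).
move=> P P2 Pc; have [Q [QP Qd]] := HP P P2 Pc; exists Q; split=> // i.
have [Qi Qs] := QP i; split=> //; exact: leq_trans Qs path_bound.
Qed.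

End Constants.

(** * Logarithms, Chernoff rates and the failure probability *)

Section Analysis.
Local Open Scope ring_scope.
Variable R : realType.

Lemma third_prob : (0 <= 1 / 3 :> R) && (1 / 3 <= 1 :> R).
Proof. by apply/andP; split; lra. Qed.

Lemma two_thirds_prob : (0 <= 1 - 1 / 3 :> R) && (1 - 1 / 3 <= 1 :> R).
Proof. by apply/andP; split; lra. Qed.

(* A base of exponential decay in Chernoff's bound: a third of a set is sampled as
   less than 3/10 of it, or two thirds as less than 5/8 of it. *)
Definition rate : R := 998 / 1000.

Lemma rate_prob : 0 <= rate <= 1.
Proof. by rewrite /rate; apply/andP; split; lra. Qed.

Lemma rate_third : 1 - 1 / 3 + 1 / 3 * (49 / 50) ^+ 10 <= rate * (49 / 50) ^+ 3.
Proof. by rewrite /rate; lra. Qed.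

Lemma rate_two_thirds : 1 - (1 - 1 / 3) + (1 - 1 / 3) * (97 / 100) ^+ 8
  <= rate * (97 / 100) ^+ 5.
Proof. by rewrite /rate; lra. Qed.

Lemma tilt_third : (0 < 49 / 50 :> R) && (49 / 50 <= 1 :> R).
Proof. by apply/andP; split; lra. Qed.

Lemma tilt_two_thirds : (0 < 97 / 100 :> R) && (97 / 100 <= 1 :> R).
Proof. by apply/andP; split; lra. Qed.

Lemma rate_half : rate ^+ 500 <= 2^-1.
Proof. by apply: expr_le_half; rewrite /rate //; lra. Qed.

Lemma ln2_gt0 : 0 < ln (2 : R).
Proof. by rewrite ln_gt0 // ltr1n. Qed.

Lemma log2_bounds n k : (2 ^ k <= n < 2 ^ k.+1)%N ->
  k%:R <= log2 (n%:R : R) <= k.+1%:R.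
Proof.
move=> /andP[kn nk]; have n0 : 0 < n%:R :> R by rewrite ltr0n; apply: leq_trans kn; rewrite expn_gt0.
have lnX m : m%:R * ln 2 = ln (2 ^+ m : R) by rewrite lnXn // mulr_natl.
rewrite /log2 ler_pdivlMr ?ln2_gt0 // ler_pdivrMr ?ln2_gt0 // !lnX.
by rewrite !ler_ln ?posrE ?exprn_gt0 // -!natrX !ler_nat kn ltnW.
Qed.

(** From [L <= k + 1 <= 2 k] the factor [eps / L^2] is at least [2^-7 / (4 k^2)], and from [k <= L]
    the deletion budget [k^135] is at most [s]. *)
Lemma expander_robust (T : finType) (G : sgraph T) (eps s : R) k : (0 < k)%N ->
  (2 ^ k <= #|T| < 2 ^ k.+1)%N -> 2 ^- 7 <= eps ->
  log2 (#|T|%:R : R) ^+ 135 <= s -> expander G eps s ->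
  robust_expander G (2 ^ 9 * k ^ 2) (k ^ 135).
Proof.
move=> k0 kn eps7 s135 expG U F FG U0 U2 FU.
have /andP[kL Lk] := log2_bounds kn; set L := log2 _ in kL Lk s135.
have k0R : 0 < k%:R :> R by rewrite ltr0n.
have L0 : 0 < L by apply: lt_le_trans kL.
have := expG U F FG U0 _ _; rewrite -/L => h.
have {h} : eps * #|U|%:R / L ^+ 2 <= #|nbhd (del_edges G F) U|%:R.
  apply: h.
    rewrite mulrAC ler_pdivlMr ?ltr0n // -!natrM ler_nat; lia.
  apply: (@le_trans _ _ (k ^ 135 * #|U|)%:R); first by rewrite ler_nat.
  rewrite natrM ler_wpM2r //; apply: le_trans s135.
  by rewrite natrX lerXn2r // nnegrE ltW.
rewrite ler_pdivrMr ?exprn_gt0 // => h; rewrite -(ler_nat R).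
have L2 : L ^+ 2 <= 4 * k%:R ^+ 2.
  have -> : 4 * k%:R ^+ 2 = (2 * k%:R) ^+ 2 :> R by ring.
  rewrite lerXn2r ?nnegrE ?(ltW L0) ?mulr_ge0 ?(ltW k0R) //.
  apply: le_trans Lk _.
  by rewrite -natrM ler_nat; lia.
have : #|U|%:R <= 2 ^+ 7 * (eps * #|U|%:R) :> R.
  rewrite mulrA ler_peMl // -ler_pdivrMl ?exprn_gt0 // mulr1 //.
move=> h1; apply: le_trans h1 _.
have -> : (2 ^ 9 * k ^ 2 * #|nbhd (del_edges G F) U|)%:R =
    2 ^+ 7 * (#|nbhd (del_edges G F) U|%:R * (4 * k%:R ^+ 2)) :> R.
  by rewrite natrM (natrM _ (2 ^ 9)%N (k ^ 2)%N) !natrX; ring.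
rewrite ler_wpM2l ?exprn_ge0 //; apply: le_trans h _.
by rewrite ler_wpM2l.
Qed.

Section Probabilities.
Variables (T : finType) (k : nat).
Hypotheses (hk : (2 ^ 32 <= k)%N) (kn : (2 ^ k <= #|T| < 2 ^ k.+1)%N).

(** Below [1 / #|T|^2], so that the union factor [2 * #|T|] still leaves a probability of order
    [1 / #|T|]. *)
Let x : R := 2^-1 ^+ k.*2.+2.

Lemma n_gt0 : (0 < #|T|)%N.
Proof. by move: kn => /andP[h _]; apply: leq_trans h; rewrite expn_gt0. Qed.

Lemma union_factor_le : 2 * #|T|%:R * x <= 2 / #|T|%:R.
Proof.
have n0 : 0 < #|T|%:R :> R by rewrite ltr0n n_gt0.
rewrite ler_pdivlMr // -mulrA -mulrA ler_piMr //.
have -> : #|T|%:R * x * #|T|%:R = (#|T|%:R * 2^-1 ^+ k.+1) ^+ 2 :> R.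
  by rewrite /x -[k.*2.+2]/(k.+1.*2) -muln2 exprM; ring.
rewrite exprn_ile1 // ?mulr_ge0 // ?exprn_ge0 ?invr_ge0 //.
rewrite exprVn ler_pdivrMr ?exprn_gt0 // mul1r -natrX ler_nat ltnW //.
by case/andP: kn.
Qed.

Lemma union_factor_le1 : 2 * #|T|%:R * x <= 1.
Proof.
apply: le_trans union_factor_le _.
rewrite ler_pdivrMr ?ltr0n ?n_gt0 // mul1r ler_nat.
case/andP: kn => h _; apply: leq_trans h; rewrite -{1}(expn1 2) leq_exp2l //.
exact: k_gt0.
Qed.

Lemma rate_le m : (500 * k.*2.+2 <= m)%N -> rate ^+ m <= x.
Proof.
have /andP[r0 r1] := rate_prob; move=> hm.
apply: (@le_trans _ _ (rate ^+ (500 * k.*2.+2))); first exact: ler_wiXn2l.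
rewrite exprM /x lerXn2r ?nnegrE ?exprn_ge0 ?invr_ge0 //.
exact: rate_half.
Qed.

Lemma prob_unfair (f : {set T} -> {set T}) :
  rand_subset_prob (1 / 3 : R) (fun V => ~ fair (k ^ 10) V f) <= 2 / #|T|%:R.
Proof.
apply: le_trans union_factor_le.
apply: le_trans (@prob_sparse_image R T _ (49 / 50) rate _ f
  10 3 (k ^ 10) third_prob tilt_third rate_prob rate_third (rate_le _) union_factor_le1).
- apply: (prob_mono third_prob) => V nf; apply: contrapT => nA; apply: nf => A A0 fA.
  rewrite leqNgt; apply/negP => lt; apply: nA; by exists A.
- have := k_ge1000 hk; rewrite (expnS k 9) (expnS k 8).
  have : (0 < k ^ 8)%N by rewrite expn_gt0 k_gt0.
  by move: (k ^ 8)%N => m; nia.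
Qed.

Lemma linear_le_n : (500 * k.*2.+2 <= #|T|)%N.
Proof.
case/andP: kn => h _; apply: leq_trans h.
apply: (@leq_trans (2 ^ (k./2 + k./2))); last by rewrite leq_exp2l //; lia.
have k2 : (2048 <= 2 ^ k./2)%N.
  have -> : (2048 = 2 ^ 11)%N by [].
  by rewrite leq_exp2l //; have := k_ge1000 hk; lia.
have := ltn_expl k./2 (isT : (1 < 2)%N); rewrite expnD => k1.
apply: leq_trans (leq_mul k2 k1); lia.
Qed.

(** The tail bound for the constant map [setT], with a singleton as [A]. *)
Lemma prob_small :
  rand_subset_prob (1 / 3 : R) (fun V : {set T} => ~ (#|T| <= 4 * #|V|)%N) <= 2 / #|T|%:R.
Proof.
have [v _] : exists v : T, v \in T by apply/card_gt0P/n_gt0.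
apply: le_trans union_factor_le.
apply: le_trans (@prob_sparse_image R T _ (49 / 50) rate _ (fun=> setT)
  10 3 #|T| third_prob tilt_third rate_prob rate_third (rate_le linear_le_n)
  union_factor_le1).
- apply: (prob_mono third_prob) => V /negP; rewrite -ltnNge => lt; exists [set v].
  rewrite cards1 muln1 setTI cardsT; split=> //; last by lia.
  by apply/set0Pn; exists v; rewrite inE.
Qed.

(** More than 3/8 of the vertices in [V] means less than 5/8 in its complement, which is sampled
    with density 2/3. *)
Lemma prob_large :
  rand_subset_prob (1 / 3 : R) (fun V : {set T} => ~ (8 * #|V| <= 3 * #|T|)%N) <= 2 / #|T|%:R.
Proof.
have [v _] : exists v : T, v \in T by apply/card_gt0P/n_gt0.
apply: le_trans union_factor_le.
apply: le_trans (@prob_sparse_image R T _ (97 / 100) rate _ (fun=> setT)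
  8 5 #|T| two_thirds_prob tilt_two_thirds rate_prob rate_two_thirds
  (rate_le linear_le_n) union_factor_le1).
- rewrite -prob_compl; apply: (prob_mono third_prob) => V /negP; rewrite -ltnNge => lt.
  exists [set v]; rewrite cards1 muln1 setTI cardsT; split=> //.
    by apply/set0Pn; exists v; rewrite inE.
  by have := cardsC V; lia.
Qed.

End Probabilities.

(** Five events may fail, with probability at most [2 / #|T|] each: the fairness of three set maps
    and the two bounds on [#|V|]. *)
Lemma prob_no_subgraph (T : finType) (G : sgraph T) (eps s : R) k :
  (2 ^ 32 <= k)%N -> (2 ^ k <= #|T| < 2 ^ k.+1)%N -> 2 ^- 7 <= eps ->
  log2 (#|T|%:R : R) ^+ 135 <= s -> expander G eps s ->
  rand_subset_prob (1 / 3 : R) (fun V : {set T} =>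
    ~ exists H : sgraph T, subgraph H G /\
        #|edges H|%:R <= 2 ^+ 9 * #|T|%:R * log2 (#|T|%:R : R) ^+ 10 /\
        path_connected H (log2 (#|T|%:R : R) ^+ 7) 2 V) <= 10 / #|T|%:R.
Proof.
move=> hk kn eps7 s135 expG.
have rexp := expander_robust (k_gt0 hk) kn eps7 s135 expG.
have /andP[kL _] := log2_bounds kn; set L := log2 _ in kL *.
pose f1 := nbhd G; pose f2 := popular G (k ^ 15).
pose f3 A := heavy G (k ^ 135) (popular G (k ^ 15) A).
have le1 := prob_unfair hk kn f1; have le2 := prob_unfair hk kn f2.
have le3 := prob_unfair hk kn f3.
have le4 := prob_small hk kn; have le5 := prob_large hk kn.
apply: (@le_trans _ _ (rand_subset_prob (1 / 3 : R) (fun V : {set T} =>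
  ~ fair (k ^ 10) V f1 \/ (~ fair (k ^ 10) V f2 \/ (~ fair (k ^ 10) V f3 \/
  (~ (#|T| <= 4 * #|V|)%N \/ ~ (8 * #|V| <= 3 * #|T|)%N)))))).
  apply: (prob_mono third_prob) => V; apply: contra_notP => good.
  have [ok1 ok2 ok3 ok4 ok5] : [/\ fair (k ^ 10) V f1, fair (k ^ 10) V f2,
      fair (k ^ 10) V f3, (#|T| <= 4 * #|V|)%N & (8 * #|V| <= 3 * #|T|)%N].
    split; apply: contrapT => h; apply: good; tauto.
  have [H [HG HE HP]] := connected_subgraph hk erefl R kn rexp ok4 ok5 ok1 ok2 ok3.
  have LX m : k%:R ^+ m <= L ^+ m.
    by rewrite lerXn2r ?nnegrE // (le_trans _ kL).
  exists H; split=> //; split.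
    apply: (@le_trans _ _ (2 ^ 9 * #|T| * k ^ 10)%:R); first by rewrite ler_nat.
    rewrite natrM (natrM _ (2 ^ 9)%N) !natrX.
    by rewrite ler_wpM2l // mulr_ge0 // exprn_ge0.
  move=> P P2 Pc; have [Q [QP Qd]] := HP P P2 Pc; exists Q; split=> // i.
  have [Qi Qs] := QP i; split=> //; apply: le_trans (LX 7).
  by rewrite -natrX ler_nat.
apply: le_trans (prob_or _ _ third_prob) _.
apply: le_trans (lerD le1 (prob_or _ _ third_prob)) _.
apply: le_trans (lerD (lexx _) (lerD le2 (prob_or _ _ third_prob))) _.
apply: le_trans (lerD (lexx _) (lerD (lexx _) (lerD le3 (prob_or _ _ third_prob)))) _.
apply: le_trans (lerD (lexx _) (lerD (lexx _) (lerD (lexx _) (lerD le4 le5)))) _.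
by rewrite -!mulrDl -!natrD.
Qed.

End Analysis.

(* The statement with high probability *)
From mathcomp Require Import all_classical all_reals all_analysis.
Import Order.TTheory GRing.Theory Num.Theory.
Import numFieldNormedType.Exports.
Local Open Scope classical_set_scope.
Local Open Scope ring_scope.

Theorem lemma20 (R : realType) :
  exists delta : nat -> R,
    (delta n @[n --> \oo] --> (0 : R)) /\
    forall (n : nat) (T : finType) (G : sgraph T) (eps s : R),
      #|T| = n ->
      2 ^- 7 <= eps -> eps <= 1 ->
      log2 (n%:R : R) ^+ 135 <= s ->
      expander G eps s ->
      rand_subset_prob (1 / 3 : R) (fun V : {set T} =>
        ~ exists H : sgraph T,
            subgraph H G /\
            #|edges H|%:R <= 2 ^+ 9 * n%:R * log2 (n%:R : R) ^+ 10 /\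
            path_connected H (log2 (n%:R : R) ^+ 7) 2 V)
      <= delta n.
Proof.
have [K hK] : exists K : nat, (2 ^ 32 <= K)%N.
  exists (2 ^ 32)%N; exact: leqnn.
(* [harmonic n] is [1 / (n + 1)], whence the 20 to dominate [10 / n]. For small [n] the trivial
   bound 1 is taken. *)
exists (fun n => if (2 ^ K <= n)%N then 20 * harmonic n else 1); split.
  have : (fun n => 20 * harmonic n : R) @ \oo --> (0 : R).
    by rewrite -[0 as X in _ --> X](mulr0 20); apply: cvgMr; exact: cvg_harmonic.
  apply: cvg_trans; apply: near_eq_cvg; near=> n.
  rewrite ifT //; near: n; exact: nbhs_infty_ge.
move=> n T G eps s <- eps7 _ s135 expG.
case: ifP => [Kn|_]; last exact: prob_le1 (third_prob R).
have n0 : (0 < #|T|)%N by apply: leq_trans Kn; rewrite expn_gt0.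
have kn := trunc_log_bounds (isT : (1 < 2)%N) n0.
set k := trunc_log 2 _ in kn.
have hk : (2 ^ 32 <= k)%N.
  by apply: leq_trans hK _; apply: trunc_log_max.
apply: le_trans (prob_no_subgraph hk kn eps7 s135 expG) _.
rewrite /harmonic ler_pdivrMr ?ltr0n // mulrAC ler_pdivlMr ?ltr0n //.
by rewrite -!natrM ler_nat; clear -n0; lia.
Unshelve. all: by end_near. Qed.
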